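(* Let $\sigma$ be a closed convex curve in $\mathbb R^2$ such that $\kappa_\sigma(q) \ge \kappa >0$ for a.e. $q\in \sigma$. Then $\kappa_{\sigma, 0} \ge \kappa$ globally, i.e. $\kappa_0(I)\ge\kappa$ for every subarc $I$ of $\sigma$.
   Context: For a subarc $I$ of $\sigma$ with endpoints $p,q$, $\kappa_0(I)$ is the curvature $\kappa$ of the circular arc in $\mathbb R^2$ of constant curvature $\kappa$ having the same length as $I$ and the same chord length $|pq|$. The arc/chord curvature $\kappa_\sigma(q)$ is the common value of $\liminf$ and $\limsup$ of $\kappa_0(I)$ over subarcs $I$ containing $q$ with $|I|\to0$ (it exists almost everywhere for convex curves). *)

(* Defs.v *)
From Stdlib Require Import Reals Lra ClassicalEpsilon.
Open Scope R_scope.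

Definition pt := (R * R)%type.

Definition dist2 (p q : pt) : R :=
  sqrt ((fst p - fst q) ^ 2 + (snd p - snd q) ^ 2).

Fixpoint polysum (g : R -> pt) (p : nat -> R) (n : nat) : R :=
  match n with
  | O => 0
  | S m => polysum g p m + dist2 (g (p (S m))) (g (p m))
  end.

Definition partition (a b : R) (p : nat -> R) (n : nat) : Prop :=
  p O = a /\ p n = b /\ (forall i, (i < n)%nat -> p i <= p (S i)).

Definition curve_length_is (g : R -> pt) (a b l : R) : Prop :=
  is_lub (fun x => exists p n, partition a b p n /\ x = polysum g p n) l.

Definition arclength_param (g : R -> pt) : Prop :=
  forall a b, a <= b -> curve_length_is g a b (b - a).

Definition convex_set (K : pt -> Prop) : Prop :=
  forall x y t, K x -> K y -> 0 <= t <= 1 ->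
    K ((1 - t) * fst x + t * fst y, (1 - t) * snd x + t * snd y).

Definition boundary (K : pt -> Prop) (x : pt) : Prop :=
  forall e, 0 < e ->
    (exists y, K y /\ dist2 x y < e) /\ (exists y, ~ K y /\ dist2 x y < e).

Definition closed_convex_curve (g : R -> pt) (L : R) : Prop :=
  0 < L /\ arclength_param g /\ (forall s, g (s + L) = g s) /\
  (forall s t, 0 <= s < L -> 0 <= t < L -> g s = g t -> s = t) /\
  exists K : pt -> Prop, convex_set K /\
    (forall x, boundary K x <-> exists s, g s = x).

(** Chord length of a circular arc in R^2 of constant curvature k and length l
    (a straight segment when k = 0). *)
Definition circ_chord (l k : R) : R :=
  if Req_EM_T k 0 then l else 2 / k * sin (k * l / 2).

(** kappa_0 for an arc of length l and chord c: the curvature k (0 <= k <= 2pi/l)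
    of the circular arc with the same length and chord. *)
Definition kappa0 (l c : R) : R :=
  epsilon (inhabits 0) (fun k => 0 <= k <= 2 * PI / l /\ circ_chord l k = c).

(** Subarcs of sigma are I = g([a,b]) with 0 < b - a < L; |I| = b - a,
    endpoints g a, g b. *)
Definition kappa0_arc (g : R -> pt) (a b : R) : R :=
  kappa0 (b - a) (dist2 (g a) (g b)).

Definition arc_contains (g : R -> pt) (a b : R) (q : pt) : Prop :=
  exists t, a <= t <= b /\ g t = q.

Definition arc_chord_limit (g : R -> pt) (L : R) (q : pt) (v : R) : Prop :=
  forall e, 0 < e -> exists d, 0 < d /\
    forall a b, a < b -> b - a < L -> b - a < d -> arc_contains g a b q ->
      Rabs (kappa0_arc g a b - v) < e.

Definition arc_chord_limit_pinfty (g : R -> pt) (L : R) (q : pt) : Prop :=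
  forall M, exists d, 0 < d /\
    forall a b, a < b -> b - a < L -> b - a < d -> arc_contains g a b q ->
      M < kappa0_arc g a b.

Definition arc_chord_curv_ge (g : R -> pt) (L : R) (q : pt) (kappa : R) : Prop :=
  (exists v, arc_chord_limit g L q v /\ kappa <= v) \/ arc_chord_limit_pinfty g L q.

Definition null_set (S : R -> Prop) : Prop :=
  forall eps, 0 < eps -> exists a b : nat -> R,
    (forall n, a n <= b n) /\
    (forall x, S x -> exists n, a n <= x <= b n) /\
    (forall N, sum_f_R0 (fun n => b n - a n) N <= eps).

(* Main.v *)
Require Import Defs.
From Stdlib Require Import Reals ZArith Lra Lia Psatz Classical ClassicalEpsilon.
Open Scope R_scope.

(** Since no subarc of positive length is straight, no three points of the curve
    are collinear, so the orientation of triples in cyclic order is constant. Cut an arc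
    at the point farthest from its chord. On each half the polar angles of chords,
    measured from the chord of the arc, lie in [[0, PI]] and increase, so a tangent
    angle [th] exists. At a point [q] whose arc/chord curvature is a finite [v], the
    angle between the chords over [[q - h, q]] and [[q, q + s]] is
    [v (h + s) / 2 + o(h)] when [h] and [s] are comparable. Telescoping over dyadic
    scales and the sine law turn this into: [th] grows at rate at least [v] near [q].
    As [th] is monotone, an a.e. bound on its growth integrates, so [th] turns by at
    least [kappa] per unit length, and integrating [cos th] over both halves bounds
    the chord by that of a circular arc of curvature [kappa]. *)

(** The obstacle is that the curvature at [q] constrains only arcs containing [q], while growth of
    [th] near [q] concerns tangents at other points. The turn at [q + s] between the chords over
    [[q, q + s]] and [[q + s, q + h]] is therefore not given; it is recovered from the small angle
    at [q] between the chords to [q + s] and [q + h]. This takes [h - s] to be a fixed small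
    fraction of [h], with errors that stay small after division by that fraction. Where the
    curvature is infinite there are no such asymptotics, but a bound with a lossy constant suffices,
    since the curvature may be taken as large as desired. The cut is needed because a whole arc may
    turn by as much as [2 * PI], and cosine decreases only on [[0, PI]]. At the farthest point the
    supporting line is parallel to the chord, so each half keeps its angles in that range. *)

(** * Bounds on sine and cosine, and the curvature [kappa0] of a circular arc *)

Lemma sin_ge_cubic x : 0 <= x <= PI -> x - x ^ 3 / 6 <= sin x.
Proof.
intros [H0 H1].
assert (P4 := PI_4).
destruct (pre_sin_bound x 0 H0 ltac:(lra)) as [H _].
unfold sin_approx, sin_term in H; simpl in H. lra.
Qed.

Lemma sin_le_quintic x : 0 <= x <= PI -> sin x <= x - x ^ 3 / 6 + x ^ 5 / 120.
Proof.
intros [H0 H1].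
assert (P4 := PI_4).
destruct (pre_sin_bound x 0 H0 ltac:(lra)) as [_ H].
unfold sin_approx, sin_term in H; simpl in H. lra.
Qed.

Lemma sin_le_id x : 0 <= x -> sin x <= x.
Proof.
intros H; destruct (Req_dec x 0) as [->|Hn].
- rewrite sin_0; lra.
- left; apply sin_lt_x; lra.
Qed.

Lemma cos_ge_quadratic x : 1 - x ^ 2 / 2 <= cos x.
Proof.
replace (cos x) with (1 - 2 * sin (x / 2) * sin (x / 2)).
2:{ rewrite <- cos_2a_sin. f_equal; lra. }
assert (H : sin (x / 2) ^ 2 <= (x / 2) ^ 2).
{ rewrite <- 2!Rsqr_pow2. apply Rsqr_le_abs_1.
  destruct (Rle_dec 0 (x / 2)).
  - rewrite (Rabs_right (x / 2)) by lra.
    apply Rabs_le. split; [|now apply sin_le_id].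
    destruct (Rle_dec (x / 2) PI).
    + assert (0 <= sin (x / 2)) by (apply sin_ge_0; lra). lra.
    + assert (P := PI2_1). generalize (SIN_bound (x / 2)). lra.
  - rewrite (Rabs_left (x / 2)) by lra.
    apply Rabs_le.
    assert (Hs := sin_le_id (- (x / 2)) ltac:(lra)).
    rewrite sin_neg in Hs. split; [lra|].
    destruct (Rle_dec (- PI) (x / 2)).
    + assert (0 <= sin (- (x / 2))) by (apply sin_ge_0; lra).
      rewrite sin_neg in H. lra.
    + assert (P := PI2_1). generalize (SIN_bound (x / 2)). lra. }
nra.
Qed.

(** Concavity of sine on [[0, PI]]: past [x] its slope is below [cos x], which is below the slope
    [sin x / x] of the chord from the origin. *)
Lemma sinc_decr x y : 0 < x -> x < y -> y <= PI -> x * sin y < y * sin x.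
Proof.
intros Hx Hxy Hy.
destruct (MVT_cor2 (fun t => t * cos x - sin t) (fun t => cos x - cos t) 0 x Hx)
  as [u [Hu [Hu0 Hu1]]].
{ intros t Ht.
  replace (cos x - cos t) with (1 * cos x + t * 0 - cos t) by ring.
  apply derivable_pt_lim_minus; [|apply derivable_pt_lim_sin].
  apply (derivable_pt_lim_mult id (fun _ => cos x));
    [apply derivable_pt_lim_id|apply derivable_pt_lim_const]. }
rewrite sin_0 in Hu.
assert (Hc1 : cos x < cos u) by (apply cos_decreasing_1; lra).
destruct (MVT_cor2 sin cos x y Hxy) as [w [Hw [Hw0 Hw1]]].
{ intros; apply derivable_pt_lim_sin. }
assert (Hc2 : cos w < cos x) by (apply cos_decreasing_1; lra).
assert (Hxx : x * cos x < sin x) by nra.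
assert (Hlt : x * (sin y - sin x) < (y - x) * sin x).
{ rewrite Hw.
  assert (x * cos w < sin x) by nra. nra. }
lra.
Qed.

(** The chord is [l] times [sin z / z] at the half angle [z = k * l / 2]. Strict decrease up to
    [z = PI] makes the value chosen by [kappa0] unique and turns bounds on chords into bounds on
    curvature. *)
Lemma circ_chord_decr l k k' : 0 < l -> 0 <= k -> k < k' -> k' * l <= 2 * PI ->
  circ_chord l k' < circ_chord l k.
Proof.
intros Hl Hk Hkk Hk'. unfold circ_chord.
destruct (Req_EM_T k' 0) as [?|_]; [lra|].
destruct (Req_EM_T k 0) as [->|Hn].
- assert (0 < k' * l / 2) by nra.
  assert (H1 := sin_lt_x (k' * l / 2) H).
  apply Rmult_lt_reg_r with k'; [lra|].
  replace (2 / k' * sin (k' * l / 2) * k') with (2 * sin (k' * l / 2)) by (field; lra).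
  lra.
- assert (H := sinc_decr (k * l / 2) (k' * l / 2) ltac:(nra) ltac:(nra) ltac:(nra)).
  apply Rmult_lt_reg_r with (k * k' * l / 4). { assert (0 < k) by lra. assert (0 < k * k') by nra. nra. }
  replace (2 / k' * sin (k' * l / 2) * (k * k' * l / 4))
    with (k * l / 2 * sin (k' * l / 2)) by (field; lra).
  replace (2 / k * sin (k * l / 2) * (k * k' * l / 4))
    with (k' * l / 2 * sin (k * l / 2)) by (field; lra).
  exact H.
Qed.

Lemma kappa0_spec l c : 0 < l -> 0 < c <= l ->
  0 <= kappa0 l c <= 2 * PI / l /\ circ_chord l (kappa0 l c) = c.
Proof.
intros Hl [Hc0 Hc1].
apply (epsilon_spec (inhabits 0) (fun k => 0 <= k <= 2 * PI / l /\ circ_chord l k = c)).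
assert (HP := PI_RGT_0).
destruct (Req_dec c l) as [->|Hn].
- exists 0. repeat split; try lra.
  + assert (0 < / l) by (now apply Rinv_0_lt_compat). unfold Rdiv; nra.
  + unfold circ_chord. destruct (Req_EM_T 0 0); lra.
(* A positive root of [f] is half the turning angle of the arc sought. Since [0] is a spurious root,
   the search starts at [x0 > 0], where the cubic bound on sine already makes [f] negative. *)
- set (f := fun x => c * x - l * sin x).
  set (x0 := (l - c) / l).
  assert (Hx0 : x0 * l = l - c) by (unfold x0; field; lra).
  assert (0 < x0 < 1) by (split; nra).
  assert (HP3 := PI2_1).
  destruct (IVT f x0 PI) as [z [Hz Hfz]].
  + unfold f. apply continuity_minus.
    * apply continuity_mult; [apply continuity_const; now intros ? ?|].
      apply derivable_continuous, derivable_id.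
    * apply continuity_mult; [apply continuity_const; now intros ? ?|].
      apply continuity_sin.
  + lra.
  + unfold f. assert (H1 := sin_ge_cubic x0 ltac:(lra)).
    assert (l * (x0 - x0 ^ 3 / 6) <= l * sin x0) by nra.
    assert (Hcx : c = l * (1 - x0)) by lra.
    assert (0 < l * x0 * (x0 - x0 ^ 2 / 6)).
    { apply Rmult_lt_0_compat; nra. }
    rewrite Hcx at 1. nra.
  + unfold f. rewrite sin_PI. nra.
  + assert (0 < z) by lra.
    assert (Hk : 2 * z / l * l = 2 * z) by (field; lra).
    assert (0 < 2 * z / l) by (apply Rdiv_lt_0_compat; lra).
    exists (2 * z / l). split.
    * split; [lra|]. unfold Rdiv.
      apply Rmult_le_compat_r; [left; now apply Rinv_0_lt_compat|lra].
    * unfold circ_chord. destruct (Req_EM_T (2 * z / l) 0); [lra|].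
      replace (2 * z / l * l / 2) with z by (field; lra).
      unfold f in Hfz.
      replace (2 / (2 * z / l) * sin z) with (l * sin z / z) by (field; lra).
      apply Rmult_eq_reg_r with z; [|lra].
      unfold Rdiv. rewrite Rmult_assoc, Rinv_l by lra. lra.
Qed.

Lemma kappa0_chord_bounds l c : 0 < l -> 0 < c <= l ->
  let x := kappa0 l c * l / 2 in
  0 <= x <= PI /\
  l * (1 - x ^ 2 / 6) <= c <= l * (1 - x ^ 2 / 6 + x ^ 4 / 120).
Proof.
intros Hl Hc x.
destruct (kappa0_spec l c Hl Hc) as [[Hk0 Hk1] Hk2].
assert (Hx : 0 <= x <= PI).
{ unfold x; split; [nra|].
  apply Rmult_le_compat_r with (r := l) in Hk1; [|lra].
  replace (2 * PI / l * l) with (2 * PI) in Hk1 by (field; lra). lra. }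
split; [exact Hx|].
unfold circ_chord in Hk2.
destruct (Req_EM_T (kappa0 l c) 0) as [E|E].
- assert (x = 0) by (unfold x; rewrite E; lra). rewrite H. lra.
- assert (Hc2 : c * x = l * sin x).
  { rewrite <- Hk2 at 1. fold x. unfold x at 2. field. exact E. }
  assert (Hx0 : 0 < x) by (unfold x; assert (0 < kappa0 l c) by lra; nra).
  assert (H1 := sin_ge_cubic x Hx). assert (H2 := sin_le_quintic x Hx).
  split; apply Rmult_le_reg_r with x; trivial; rewrite Hc2.
  + replace (l * (1 - x ^ 2 / 6) * x) with (l * (x - x ^ 3 / 6)) by (field; lra). nra.
  + replace (l * (1 - x ^ 2 / 6 + x ^ 4 / 120) * x)
      with (l * (x - x ^ 3 / 6 + x ^ 5 / 120)) by (field; lra). nra.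
Qed.

Lemma kappa0_segment l : 0 < l -> kappa0 l l = 0.
Proof.
intros Hl.
destruct (kappa0_spec l l Hl ltac:(lra)) as [[Hk0 Hk1] Hk2].
destruct (Req_dec (kappa0 l l) 0) as [|Hn]; [trivial|exfalso].
apply Rmult_le_compat_r with (r := l) in Hk1; [|lra].
replace (2 * PI / l * l) with (2 * PI) in Hk1 by (field; lra).
assert (H := circ_chord_decr l 0 (kappa0 l l) Hl (Rle_refl 0) ltac:(lra) Hk1).
rewrite Hk2 in H. unfold circ_chord in H.
destruct (Req_EM_T 0 0); lra.
Qed.

Lemma kappa0_ge l c k : 0 < l -> 0 < c <= l -> 0 < k -> k * l <= 2 * PI ->
  c <= 2 / k * sin (k * l / 2) -> k <= kappa0 l c.
Proof.
intros Hl Hc Hk Hkl Hle.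
destruct (kappa0_spec l c Hl Hc) as [[Hk0 Hk1] Hk2].
apply Rnot_lt_le; intros Hlt.
assert (H := circ_chord_decr l _ k Hl Hk0 Hlt Hkl).
rewrite Hk2 in H. unfold circ_chord in H.
destruct (Req_EM_T k 0); lra.
Qed.

(** Cousin's lemma. *)
Lemma interval_induction (P : R -> R -> Prop) a b : a <= b ->
  (forall x y z, a <= x <= y -> y <= z <= b -> P x y -> P y z -> P x z) ->
  (forall q, a <= q <= b -> exists r, 0 < r /\
     forall x y, a <= x <= q -> q <= y <= b -> y - x < r -> P x y) ->
  P a b.
Proof.
intros Hab Hadd Hloc.
set (S := fun x => a <= x <= b /\ P a x).
assert (Sa : S a).
{ split; [lra|]. destruct (Hloc a ltac:(lra)) as [r [Hr H]]. apply H; lra. }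
destruct (completeness S) as [m [Hub Hlub]].
- exists b. intros x [Hx _]; lra.
- now exists a.
- assert (Hm : a <= m <= b).
  { split; [now apply Hub|]. apply Hlub. intros x [Hx _]; lra. }
  destruct (Hloc m Hm) as [r [Hr H]].
  assert (exists x, S x /\ m - r / 2 < x) as [x [[Hx HP] Hxm]].
  { apply NNPP; intros Hn.
    assert (m <= m - r / 2); [|lra].
    apply Hlub. intros x HS. apply Rnot_lt_le; intros Hlt. apply Hn; eauto. }
  assert (x <= m) by (apply Hub; split; [lra|trivial]).
  set (y := Rmin b (m + r / 4)).
  assert (Hy : m <= y <= b /\ y <= m + r / 4).
  { unfold y, Rmin; destruct (Rle_dec b (m + r / 4)); lra. }
  assert (HPy : P a y).
  { apply Hadd with x; try lra; trivial. apply H; lra. }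
  assert (y <= m) by (apply Hub; split; [lra|trivial]).
  assert (Hyb : y = b); [|now rewrite <- Hyb].
  revert Hy H1. unfold y, Rmin; destruct (Rle_dec b (m + r / 4)); lra.
Qed.

(** * Growth of monotone functions off a null set *)

(** For [a <= b], the length of the part of [[a, b]] to the left of [x], up to a constant in [x]:
    increments of finite sums of such functions measure how much of an interval a cover meets. *)
Definition clip_length (a b x : R) : R := Rmin x b - Rmin x a.

Lemma clip_length_incr a b x y : a <= b -> x <= y -> clip_length a b x <= clip_length a b y.
Proof.
intros; unfold clip_length, Rmin; repeat destruct (Rle_dec _ _); lra.
Qed.

Lemma clip_length_inside a b x y : a <= x -> x <= y -> y <= b ->
  clip_length a b y - clip_length a b x = y - x.
Proof.
intros; unfold clip_length, Rmin; repeat destruct (Rle_dec _ _); lra.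
Qed.

Lemma clip_length_total a b x y : a <= b -> clip_length a b y - clip_length a b x <= b - a.
Proof.
intros; unfold clip_length, Rmin; repeat destruct (Rle_dec _ _); lra.
Qed.

Lemma sum_clip_length_inside (u v : nat -> R) n N x y : (forall n, u n <= v n) ->
  (n <= N)%nat -> u n <= x -> x <= y -> y <= v n ->
  y - x <= sum_f_R0 (fun n => clip_length (u n) (v n) y) N
           - sum_f_R0 (fun n => clip_length (u n) (v n) x) N.
Proof.
intros Huv HnN Hx Hxy Hy. rewrite <- minus_sum.
assert (Hpos : forall k,
  0 <= clip_length (u k) (v k) y - clip_length (u k) (v k) x).
{ intros k; generalize (clip_length_incr (u k) (v k) x y (Huv k) Hxy); lra. }
assert (Hsum : forall m,
  0 <= sum_f_R0 (fun n => clip_length (u n) (v n) y - clip_length (u n) (v n) x) m).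
{ intros m; apply cond_pos_sum; auto. }
induction N as [|N IH]; simpl.
- assert (n = 0)%nat by lia; subst. rewrite clip_length_inside; lra.
- destruct (Nat.eq_dec n (S N)) as [->|Hne].
  + rewrite (clip_length_inside (u (S N))) by trivial.
    specialize (Hsum N); lra.
  + specialize (IH ltac:(lia)). specialize (Hpos (S N)). lra.
Qed.

Lemma geometric_sum_le N : sum_f_R0 (fun n => (1 / 2) ^ n) N <= 2.
Proof.
assert (sum_f_R0 (fun n => (1 / 2) ^ n) N = 2 - (1 / 2) ^ N) as ->.
{ induction N; simpl; [lra|]. rewrite IHN. lra. }
assert (0 < (1 / 2) ^ N) by (apply pow_lt; lra). lra.
Qed.

(** Slope bounds off a null set integrate for monotone functions: the slope
    missing on the exceptional set is at most the length of a cover of it. *)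
Lemma monotone_growth (F : R -> R) (E : R -> Prop) k a b : a <= b -> 0 <= k ->
  (forall x y, a <= x -> x <= y -> y <= b -> F x <= F y) ->
  null_set E ->
  (forall q, a <= q <= b -> ~ E q -> exists r, 0 < r /\
     forall x y, a <= x <= q -> q <= y <= b -> y - x < r -> k * (y - x) <= F y - F x) ->
  k * (b - a) <= F b - F a.
Proof.
intros Hab Hk Hmon Hnull Hloc.
apply le_epsilon; intros eps Heps.
assert (Hk1 : 0 < k + 1) by lra.
(* A cover of length [e], enlarged by [e * (1 / 2) ^ n] at both ends of interval [n], has length at
   most [e + 4 * e], and [k] times this is below [eps]. The enlargement gives each exceptional point
   room on both sides. *)
set (e := eps / (5 * (k + 1))).
assert (He : 0 < e) by (apply Rdiv_lt_0_compat; lra).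
destruct (Hnull e He) as [u [v [Huv [Hcov Hlen]]]].
set (u' n := u n - e * (1 / 2) ^ n).
set (v' n := v n + e * (1 / 2) ^ n).
assert (Hp : forall n, 0 < e * (1 / 2) ^ n).
{ intros n; apply Rmult_lt_0_compat; trivial; apply pow_lt; lra. }
assert (Huv' : forall n, u' n <= v' n).
{ intros n; unfold u', v'; generalize (Huv n) (Hp n); lra. }
assert (Hlen' : forall N, sum_f_R0 (fun n => v' n - u' n) N <= 5 * e).
{ intros N.
  assert (sum_f_R0 (fun n => v' n - u' n) N =
    sum_f_R0 (fun n => v n - u n) N + (2 * e) * sum_f_R0 (fun n => (1 / 2) ^ n) N) as ->.
  { rewrite scal_sum, <- plus_sum. apply sum_eq. intros i _. unfold u', v'; ring. }
  generalize (Hlen N) (geometric_sum_le N). nra. }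
set (m N x := sum_f_R0 (fun n => clip_length (u' n) (v' n) x) N).
assert (Hm : forall N x y, x <= y -> m N x <= m N y).
{ intros N x y Hxy. unfold m. apply sum_Rle. intros n _. now apply clip_length_incr. }
(* Each local inequality needs at most one interval of the cover, and gluing two takes the larger
   index, so a finite partial sum serves all of [[a, b]]. *)
assert (HP : exists N0, forall N, (N0 <= N)%nat ->
  k * (b - a) <= F b - F a + k * (m N b - m N a)).
{ apply (interval_induction (fun x y => exists N0, forall N, (N0 <= N)%nat ->
    k * (y - x) <= F y - F x + k * (m N y - m N x))); trivial.
  - intros x y z _ _ [N1 H1] [N2 H2]. exists (Nat.max N1 N2). intros N HN.
    specialize (H1 N ltac:(lia)). specialize (H2 N ltac:(lia)). lra.
  - intros q Hq. destruct (classic (E q)) as [Eq|Eq].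
    + destruct (Hcov q Eq) as [n Hn].
      exists (e * (1 / 2) ^ n). split; [apply Hp|].
      intros x y Hx Hy Hxy. exists n. intros N HN.
      assert (H := sum_clip_length_inside u' v' n N x y Huv' HN
        ltac:(unfold u'; lra) ltac:(lra) ltac:(unfold v'; lra)).
      fold (m N x) (m N y) in H.
      assert (F x <= F y) by (apply Hmon; lra). nra.
    + destruct (Hloc q Hq Eq) as [r [Hr H]]. exists r. split; trivial.
      intros x y Hx Hy Hxy. exists O. intros N _.
      specialize (H x y Hx Hy Hxy).
      specialize (Hm N x y ltac:(lra)). nra. }
destruct HP as [N HN]. specialize (HN N (le_n N)).
assert (Hmab : m N b - m N a <= 5 * e).
{ apply Rle_trans with (2 := Hlen' N). unfold m. rewrite <- minus_sum.
  apply sum_Rle. intros n _. now apply clip_length_total. }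
assert (e * (5 * (k + 1)) = eps) by (unfold e; field; lra).
nra.
Qed.

(** * Strict convexity *)

Lemma Rabs_le_bounds x a : Rabs x <= a -> - a <= x <= a.
Proof. unfold Rabs; destruct (Rcase_abs x); lra. Qed.

Definition orient (p q r : pt) : R :=
  (fst q - fst p) * (snd r - snd p) - (snd q - snd p) * (fst r - fst p).

Definition lerp (t : R) (p q : pt) : pt :=
  ((1 - t) * fst p + t * fst q, (1 - t) * snd p + t * snd q).

(** Boxes rather than discs: bounds on the coordinates feed directly into the bilinear [orient]. *)
Definition near (e : R) (p q : pt) : Prop :=
  Rabs (fst q - fst p) < e /\ Rabs (snd q - snd p) < e.

(** [K] may contain any part of its boundary, so the convexity arguments must run with points of the
    closure. *)
Definition in_closure (K : pt -> Prop) (p : pt) : Prop :=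
  forall e, 0 < e -> exists q, K q /\ near e p q.

Definition in_interior (K : pt -> Prop) (p : pt) : Prop :=
  exists e, 0 < e /\ forall q, near e p q -> K q.

Lemma dist2_nonneg p q : 0 <= dist2 p q.
Proof. apply sqrt_pos. Qed.

Lemma dist2_sqr p q : dist2 p q ^ 2 = (fst p - fst q) ^ 2 + (snd p - snd q) ^ 2.
Proof.
unfold dist2. rewrite <- Rsqr_pow2, Rsqr_sqrt; trivial.
generalize (pow2_ge_0 (fst p - fst q)) (pow2_ge_0 (snd p - snd q)); lra.
Qed.

Lemma dist2_sym p q : dist2 p q = dist2 q p.
Proof. unfold dist2; f_equal; ring. Qed.

Lemma dist2_pos p q : p <> q -> 0 < dist2 p q.
Proof.
intros Hn. destruct (dist2_nonneg p q) as [H|H]; trivial. exfalso; apply Hn.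
assert (Hs := dist2_sqr p q). rewrite <- H in Hs.
rewrite (surjective_pairing p), (surjective_pairing q).
f_equal; apply Rminus_diag_uniq, Rsqr_0_uniq, Rle_antisym; try apply Rle_0_sqr;
  unfold Rsqr.
- generalize (pow2_ge_0 (snd p - snd q)). lra.
- generalize (pow2_ge_0 (fst p - fst q)). lra.
Qed.

Lemma dist2_near p q e : dist2 p q < e -> near e p q.
Proof.
intros H. assert (Hs := dist2_sqr p q). assert (H0 := dist2_nonneg p q).
assert (H1 := pow2_ge_0 (fst p - fst q)). assert (H2 := pow2_ge_0 (snd p - snd q)).
rewrite <- (Rabs_right (dist2 p q)) in H by lra.
split; apply Rle_lt_trans with (2 := H); apply Rsqr_le_abs_0; rewrite !Rsqr_pow2; lra.
Qed.

Lemma boundary_in_closure K p : boundary K p -> in_closure K p.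
Proof.
intros H e He. destruct (H e He) as [[q [Kq Hq]] _].
exists q; split; trivial; now apply dist2_near.
Qed.

Lemma boundary_not_interior K p : boundary K p -> ~ in_interior K p.
Proof.
intros H [e [He Hi]]. destruct (H e He) as [_ [q [Kq Hq]]].
apply Kq, Hi. now apply dist2_near.
Qed.

Lemma in_closure_lerp K t p q : convex_set K -> 0 <= t <= 1 ->
  in_closure K p -> in_closure K q -> in_closure K (lerp t p q).
Proof.
intros HK Ht Hp Hq e He.
destruct (Hp (e / 2) ltac:(lra)) as [p' [Kp [P1 P2]]].
destruct (Hq (e / 2) ltac:(lra)) as [q' [Kq [Q1 Q2]]].
exists (lerp t p' q'). split; [now apply HK|].
apply Rabs_def2 in P1, P2, Q1, Q2.
split; simpl; apply Rabs_def1; nra.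
Qed.

Lemma Rmult_close a b a' b' d : Rabs (a' - a) <= d -> Rabs (b' - b) <= d ->
  Rabs (a' * b' - a * b) <= d * (Rabs a + Rabs b + d).
Proof.
intros Ha Hb.
replace (a' * b' - a * b) with ((a' - a) * b + a * (b' - b) + (a' - a) * (b' - b)) by ring.
apply Rle_trans with (1 := Rabs_triang _ _).
assert (H := Rabs_triang ((a' - a) * b) (a * (b' - b))).
rewrite !Rabs_mult in *.
generalize (Rabs_pos a) (Rabs_pos b) (Rabs_pos (a' - a)) (Rabs_pos (b' - b)). nra.
Qed.

Lemma orient_stable p q r : 0 < orient p q r -> exists e, 0 < e /\
  forall p' q' r', near e p p' -> near e q q' -> near e r r' -> 0 < orient p' q' r'.
Proof.
intros H. unfold orient in *.
set (S := Rabs (fst q - fst p) + Rabs (snd r - snd p)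
  + (Rabs (snd q - snd p) + Rabs (fst r - fst p))).
set (D := (fst q - fst p) * (snd r - snd p) - (snd q - snd p) * (fst r - fst p)) in *.
assert (HS : 0 <= S) by (unfold S; repeat apply Rplus_le_le_0_compat; apply Rabs_pos).
(* The two products in [orient] together move by at most [2 * e * S + 8 * e ^ 2]; since [e <= 1],
   the constant [9] leaves strict room. *)
set (e := Rmin 1 (D / (2 * S + 9))).
assert (He : 0 < e) by (apply Rmin_glb_lt; [lra|apply Rdiv_lt_0_compat; lra]).
assert (He1 : e <= 1) by apply Rmin_l.
assert (HeD : e * (2 * S + 9) <= D).
{ apply Rle_trans with (D / (2 * S + 9) * (2 * S + 9)).
  - apply Rmult_le_compat_r; [lra|apply Rmin_r].
  - right; field; lra. }
exists e. split; trivial.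
intros p' q' r' [P1 P2] [Q1 Q2] [R1 R2].
apply Rabs_def2 in P1, P2, Q1, Q2, R1, R2.
assert (H1 := Rmult_close (fst q - fst p) (snd r - snd p) (fst q' - fst p') (snd r' - snd p')
  (2 * e) ltac:(apply Rabs_le; lra) ltac:(apply Rabs_le; lra)).
assert (H2 := Rmult_close (snd q - snd p) (fst r - fst p) (snd q' - snd p') (fst r' - fst p')
  (2 * e) ltac:(apply Rabs_le; lra) ltac:(apply Rabs_le; lra)).
apply Rabs_le_bounds in H1, H2.
unfold D in HeD. unfold S in *. nra.
Qed.

Lemma Rdiv_unit_interval x y : 0 < x -> x < y -> 0 <= x / y <= 1.
Proof.
intros Hx Hy. split.
- left; apply Rdiv_lt_0_compat; lra.
- apply Rmult_le_reg_r with y; [lra|]. unfold Rdiv. rewrite Rmult_assoc, Rinv_l; lra.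
Qed.

(** The three orientations are the unnormalized barycentric coordinates of [p]. As convexity joins
    two points at a time, [a] and [b] are combined first. *)
Lemma triangle_in_convex K a b c p : convex_set K -> K a -> K b -> K c ->
  0 < orient p b c -> 0 < orient p c a -> 0 < orient p a b -> K p.
Proof.
intros HK Ka Kb Kc H1 H2 H3.
set (u := orient p b c) in *. set (v := orient p c a) in *. set (w := orient p a b) in *.
assert (Kab := HK a b (v / (u + v)) Ka Kb (Rdiv_unit_interval v (u + v) ltac:(lra) ltac:(lra))).
assert (Kp := HK _ c (w / (u + v + w)) Kab Kc
  (Rdiv_unit_interval w (u + v + w) ltac:(lra) ltac:(lra))).
simpl in Kp.
replace p with ((1 - w / (u + v + w)) * ((1 - v / (u + v)) * fst a + v / (u + v) * fst b)
    + w / (u + v + w) * fst c,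
  (1 - w / (u + v + w)) * ((1 - v / (u + v)) * snd a + v / (u + v) * snd b)
    + w / (u + v + w) * snd c); [exact Kp|].
rewrite (surjective_pairing p) at 1.
assert (Hx : u * fst a + v * fst b + w * fst c = (u + v + w) * fst p)
  by (unfold u, v, w, orient; ring).
assert (Hy : u * snd a + v * snd b + w * snd c = (u + v + w) * snd p)
  by (unfold u, v, w, orient; ring).
clearbody u v w.
f_equal; [replace (fst p) with ((u * fst a + v * fst b + w * fst c) / (u + v + w))
  by (rewrite Hx; field; lra)|replace (snd p) with ((u * snd a + v * snd b + w * snd c) / (u + v + w))
  by (rewrite Hy; field; lra)]; field; lra.
Qed.

(** Positive orientation is an open condition, so the vertices can be moved into [K] while [p] moves
    to any nearby point. *)
Lemma triangle_interior K a b c p : convex_set K ->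
  in_closure K a -> in_closure K b -> in_closure K c ->
  0 < orient p b c -> 0 < orient p c a -> 0 < orient p a b -> in_interior K p.
Proof.
intros HK Ha Hb Hc H1 H2 H3.
destruct (orient_stable _ _ _ H1) as [e1 [He1 S1]].
destruct (orient_stable _ _ _ H2) as [e2 [He2 S2]].
destruct (orient_stable _ _ _ H3) as [e3 [He3 S3]].
set (e := Rmin e1 (Rmin e2 e3)).
assert (He : 0 < e) by (repeat apply Rmin_glb_lt; trivial).
assert (Hle : e <= e1 /\ e <= e2 /\ e <= e3).
{ unfold e. generalize (Rmin_l e1 (Rmin e2 e3)) (Rmin_r e1 (Rmin e2 e3))
    (Rmin_l e2 e3) (Rmin_r e2 e3). lra. }
assert (W : forall p q d, near e p q -> e <= d -> near d p q) by (intros ? ? ? [? ?] ?; split; lra).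
destruct (Ha e He) as [a' [Ka Na]]. destruct (Hb e He) as [b' [Kb Nb]].
destruct (Hc e He) as [c' [Kc Nc]].
exists e. split; trivial. intros q Hq.
apply (triangle_in_convex K a' b' c'); trivial; [apply S1|apply S2|apply S3];
  apply W; tauto.
Qed.

Lemma small_convex_coefficient u v : 0 < u ->
  exists t, 0 < t < 1 /\ 0 < (1 - t) * u + t * v.
Proof.
intros Hu. assert (0 <= Rabs v) by apply Rabs_pos.
assert (- v <= Rabs v) by (rewrite <- Rabs_Ropp; apply Rle_abs).
assert (H2 : u / (2 * (u + Rabs v)) * (2 * (u + Rabs v)) = u) by (field; lra).
assert (H3 : 0 < u / (2 * (u + Rabs v))) by (apply Rdiv_lt_0_compat; lra).
(* With this value the combination keeps at least half of [u]. *)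
exists (u / (2 * (u + Rabs v))).
set (t := u / (2 * (u + Rabs v))) in *. clearbody t.
repeat split; nra.
Qed.

(** The point lies on the edge [a b] of the triangle [d b a]. Pushing [b] and [a] slightly towards
    [c] moves that edge past the point, which then lies strictly inside. *)
Lemma segment_interior K a b c d t : convex_set K ->
  in_closure K a -> in_closure K b -> in_closure K c -> in_closure K d ->
  0 < t < 1 -> 0 < orient a b c -> orient a b d < 0 -> in_interior K (lerp t a b).
Proof.
intros HK Ha Hb Hc Hd Ht H1 H2.
set (p := lerp t a b).
assert (E1 : 0 < orient p d b).
{ replace (orient p d b) with (- (1 - t) * orient a b d) by (unfold p, lerp, orient; simpl; ring).
  nra. }
assert (E2 : 0 < orient p a d).
{ replace (orient p a d) with (- t * orient a b d) by (unfold p, lerp, orient; simpl; ring).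
  nra. }
destruct (small_convex_coefficient _ (orient p d c) E1) as [s1 [Hs1 F1]].
destruct (small_convex_coefficient _ (orient p c d) E2) as [s2 [Hs2 F2]].
apply (triangle_interior K d (lerp s1 b c) (lerp s2 a c)); trivial;
  try (apply in_closure_lerp; trivial; lra).
- replace (orient p (lerp s1 b c) (lerp s2 a c))
    with (((1 - t) * (1 - s1) * s2 + t * s1 * (1 - s2)) * orient a b c)
    by (unfold p, lerp, orient; simpl; ring).
  apply Rmult_lt_0_compat; trivial.
  assert (0 < (1 - t) * (1 - s1) * s2) by (repeat apply Rmult_lt_0_compat; lra).
  assert (0 < t * s1 * (1 - s2)) by (repeat apply Rmult_lt_0_compat; lra). lra.
- replace (orient p (lerp s2 a c) d) with ((1 - s2) * orient p a d + s2 * orient p c d)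
    by (unfold lerp, orient; simpl; ring). trivial.
- replace (orient p d (lerp s1 b c)) with ((1 - s1) * orient p d b + s1 * orient p d c)
    by (unfold lerp, orient; simpl; ring). trivial.
Qed.

Definition locally_straight (g : R -> pt) (t : R) : Prop :=
  exists p q h, p <> q /\ 0 < h /\ forall r, Rabs (r - t) < h -> orient p q (g r) = 0.

(** If the curve leaves the line through three collinear points, it stays on one
    side of it, and near the middle point the open triangles based on the two
    outer points fill up that side. *)
Lemma collinear_locally_straight K (g : R -> pt) s t u l : convex_set K ->
  (forall r, boundary K (g r)) -> (forall x y, dist2 (g x) (g y) <= Rabs (x - y)) ->
  0 < l < 1 -> g s <> g u -> g t = lerp l (g s) (g u) -> locally_straight g t.
Proof.
intros HK Hbd Hlip Hl Hsu Ht.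
assert (Hcl : forall r, in_closure K (g r)) by (intros; now apply boundary_in_closure).
assert (Main : forall A B m, A <> B -> in_closure K A -> in_closure K B -> 0 < m < 1 ->
  g t = lerp m A B -> (exists r, 0 < orient A B (g r)) -> locally_straight g t).
{ intros A B m HAB HA HB Hm HtAB [r0 Hr0].
  assert (E1 : 0 < orient (g t) B (g r0)).
  { rewrite HtAB.
    replace (orient (lerp m A B) B (g r0)) with ((1 - m) * orient A B (g r0))
      by (unfold lerp, orient; simpl; ring). nra. }
  assert (E2 : 0 < orient (g t) (g r0) A).
  { rewrite HtAB.
    replace (orient (lerp m A B) (g r0) A) with (m * orient A B (g r0))
      by (unfold lerp, orient; simpl; ring). nra. }
  destruct (orient_stable _ _ _ E1) as [e1 [He1 S1]].
  destruct (orient_stable _ _ _ E2) as [e2 [He2 S2]].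
  exists A, B, (Rmin e1 e2). split; trivial. split; [now apply Rmin_glb_lt|].
  intros r Hr.
  assert (Nr : near (Rmin e1 e2) (g t) (g r)).
  { apply dist2_near. rewrite dist2_sym. now apply Rle_lt_trans with (1 := Hlip r t). }
  assert (N0 : forall e p, 0 < e -> near e p p).
  { intros e p He. split; rewrite Rminus_diag, Rabs_R0; trivial. }
  (* Beyond the line, [g r] would put [g t] in the interior; on the side of [g r0], [g r] itself
     would lie inside the triangle with base [A B] and apex [g r0]. *)
  destruct (Rtotal_order (orient A B (g r)) 0) as [Hneg|[H0|Hpos]]; trivial; exfalso.
  - apply (boundary_not_interior K (g t)); trivial. rewrite HtAB.
    apply (segment_interior K A B (g r0) (g r)); trivial.
  - apply (boundary_not_interior K (g r)); trivial.
    apply (triangle_interior K A B (g r0)); trivial.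
    + apply S1; [|now apply N0|now apply N0].
      destruct Nr. split; generalize (Rmin_l e1 e2); lra.
    + apply S2; [|now apply N0|now apply N0].
      destruct Nr. split; generalize (Rmin_r e1 e2); lra.
    + replace (orient (g r) A B) with (orient A B (g r)) by (unfold orient; ring). trivial. }
destruct (classic (exists r, 0 < orient (g s) (g u) (g r))) as [H|H1].
{ now apply (Main (g s) (g u) l). }
destruct (classic (exists r, 0 < orient (g u) (g s) (g r))) as [H|H2].
{ apply (Main (g u) (g s) (1 - l)); trivial; try lra; [congruence|].
  rewrite Ht. unfold lerp. f_equal; ring. }
exists (g s), (g u), 1. split; trivial. split; [lra|]. intros r _.
apply Rle_antisym; apply Rnot_lt_le; intros H; [apply H1|apply H2]; exists r; trivial.
unfold orient in *. lra.
Qed.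

Definition injective_mod (g : R -> pt) (L : R) : Prop :=
  forall s t, s < t -> t < s + L -> g s <> g t.

(** If [f m] were not strictly between the end values, the intermediate value theorem would repeat
    the value [f a] on [[m, b]] or the value [f b] on [[a, m]]. *)
Lemma injective_between (f : R -> R) a m b : continuity f ->
  (forall x y, a <= x -> x < y -> y <= b -> f x <> f y) -> a < m -> m < b ->
  0 < (f m - f a) * (f b - f m).
Proof.
intros Hf Hinj Ham Hmb.
assert (Hval : forall w, continuity (fun x => f x - w)).
{ intros w. apply continuity_minus; [exact Hf|apply continuity_const; now intros ? ?]. }
assert (N1 := Hinj a m ltac:(lra) Ham ltac:(lra)).
assert (N2 := Hinj m b ltac:(lra) Hmb ltac:(lra)).
apply Rnot_le_lt; intros Hle.
destruct (Rle_dec ((f m - f a) * (f b - f a)) 0) as [H|H].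
- destruct (IVT_cor (fun x => f x - f a) m b (Hval _) ltac:(lra) H) as [z [Hz Ez]].
  apply (Hinj a z); lra.
- assert (H' : (f a - f b) * (f m - f b) <= 0).
  { assert (0 < (f m - f a) * (f m - f a)) by nra.
    assert (0 < (f m - f b) * (f m - f b)) by nra.
    assert (0 <= (f m - f a) * (f m - f b)) by lra.
    apply Rnot_lt_le; intros Hc.
    assert (0 < (f m - f a) * (f b - f a) * ((f a - f b) * (f m - f b))) by nra.
    assert ((f m - f a) * (f b - f a) * ((f a - f b) * (f m - f b)) =
      - ((f b - f a) * (f b - f a) * ((f m - f a) * (f m - f b)))) by ring.
    assert (0 <= (f b - f a) * (f b - f a)) by nra. nra. }
  destruct (IVT_cor (fun x => f x - f b) a m (Hval _) ltac:(lra) H') as [z [Hz Ez]].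
  apply (Hinj z b); lra.
Qed.

Lemma lipschitz_continuity (f : R -> R) C : 0 < C ->
  (forall x y, Rabs (f x - f y) <= C * Rabs (x - y)) -> continuity f.
Proof.
intros HC H x e He. exists (e / C). split; [now apply Rdiv_lt_0_compat|].
intros y [_ Hy]. simpl in *. unfold Rdist in *.
apply Rle_lt_trans with (1 := H y x).
apply Rmult_lt_compat_l with (r := C) in Hy; trivial.
replace (C * (e / C)) with e in Hy by (field; lra). trivial.
Qed.

(** Let [z] be the coordinate along the line. Distances on the arc are differences of [z], and
    injectivity makes [z] monotone, so every polygonal sum telescopes to the chord. *)
Lemma straight_arc_chord (g : R -> pt) L p q a b : arclength_param g ->
  (forall x y, dist2 (g x) (g y) <= Rabs (x - y)) -> injective_mod g L ->
  a < b -> b < a + L -> p <> q -> (forall r, a <= r <= b -> orient p q (g r) = 0) ->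
  dist2 (g a) (g b) = b - a.
Proof.
intros Harc Hlip Hinj Hab HbL Hpq Hline.
set (D := dist2 p q). assert (HD : 0 < D) by now apply dist2_pos.
assert (HD2 : D ^ 2 = (fst p - fst q) ^ 2 + (snd p - snd q) ^ 2) by apply dist2_sqr.
set (z r := ((fst (g r) - fst p) * (fst q - fst p) + (snd (g r) - snd p) * (snd q - snd p)) / D).
assert (HzD : forall r, z r * D = (fst (g r) - fst p) * (fst q - fst p)
    + (snd (g r) - snd p) * (snd q - snd p)) by (intros; unfold z; field; lra).
assert (Hzz : forall x y, (z x - z y) * D = (fst (g x) - fst (g y)) * (fst q - fst p)
    + (snd (g x) - snd (g y)) * (snd q - snd p)).
{ intros. rewrite Rmult_minus_distr_r, !HzD. ring. }
assert (Hsq : forall A B, Rabs A <= Rabs B -> A ^ 2 <= B ^ 2).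
{ intros A B H. rewrite <- !Rsqr_pow2. now apply Rsqr_le_abs_1. }
assert (Hzlip : forall x y, Rabs (z x - z y) <= 1 * Rabs (x - y)).
{ intros x y. rewrite Rmult_1_l. apply Rle_trans with (2 := Hlip x y).
  rewrite <- (Rabs_right (dist2 (g x) (g y))) by (apply Rle_ge, dist2_nonneg).
  apply Rsqr_le_abs_0. rewrite !Rsqr_pow2, dist2_sqr.
  apply Rmult_le_reg_r with (D ^ 2); [nra|].
  rewrite <- Rpow_mult_distr, Hzz, HD2.
  assert (0 <= ((fst (g x) - fst (g y)) * (snd q - snd p) - (snd (g x) - snd (g y)) * (fst q - fst p)) ^ 2)
    by apply pow2_ge_0. nra. }
assert (Hzd : forall x y, a <= x <= b -> a <= y <= b -> dist2 (g x) (g y) = Rabs (z x - z y)).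
{ intros x y Hx Hy. assert (Ox := Hline x Hx). assert (Oy := Hline y Hy).
  unfold orient in Ox, Oy.
  rewrite <- (Rabs_right (dist2 (g x) (g y))) by (apply Rle_ge, dist2_nonneg).
  apply Rsqr_eq_abs_0. rewrite !Rsqr_pow2, dist2_sqr.
  apply Rmult_eq_reg_r with (D ^ 2); [|nra].
  rewrite <- Rpow_mult_distr, Hzz, HD2.
  assert (E : (fst (g x) - fst (g y)) * (snd q - snd p) - (snd (g x) - snd (g y)) * (fst q - fst p) = 0) by lra.
  apply Rminus_diag_uniq.
  replace (_ - _) with (((fst (g x) - fst (g y)) * (snd q - snd p) - (snd (g x) - snd (g y)) * (fst q - fst p)) ^ 2) by ring.
  rewrite E. ring. }
assert (Hzc : continuity z) by (apply lipschitz_continuity with 1; [lra|trivial]).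
assert (Hzinj : forall x y, a <= x -> x < y -> y <= b -> z x <> z y).
{ intros x y Hx Hxy Hy E. apply (Hinj x y); try lra.
  apply NNPP; intros Hn. apply dist2_pos in Hn.
  rewrite Hzd, E, Rminus_diag, Rabs_R0 in Hn by lra. lra. }
assert (Hadd : forall x y, a <= x -> x <= y -> y <= b ->
  Rabs (z y - z a) = Rabs (z x - z a) + Rabs (z y - z x)).
{ intros x y Hx Hxy Hy.
  destruct (Req_dec a x) as [<-|Hax]. { rewrite Rminus_diag, Rabs_R0; lra. }
  destruct (Req_dec x y) as [<-|Hxy']. { rewrite (Rminus_diag (z x)), Rabs_R0; lra. }
  assert (H := injective_between z a x y Hzc ltac:(intros; apply Hzinj; lra) ltac:(lra) ltac:(lra)).
  unfold Rabs; repeat destruct (Rcase_abs _); nra. }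
assert (Hpoly : forall n pp, pp O = a -> (forall i, (i < n)%nat -> pp i <= pp (S i)) ->
  pp n <= b -> a <= pp n /\ polysum g pp n = Rabs (z (pp n) - z a)).
{ induction n as [|n IH]; intros pp H0 Hmon Hb; simpl.
  - rewrite H0, Rminus_diag, Rabs_R0. lra.
  - assert (Hn := Hmon n ltac:(lia)).
    destruct (IH pp H0 ltac:(intros; apply Hmon; lia) ltac:(lra)) as [I1 I2].
    split; [lra|]. rewrite I2, (Hadd (pp n) (pp (S n))), Hzd by lra. lra. }
destruct (Harc a b ltac:(lra)) as [_ Hlub].
apply Rle_antisym.
- generalize (Hlip a b). rewrite Rabs_minus_sym, (Rabs_right (b - a)) by lra. trivial.
- apply Hlub. intros x [pp [n [[H0 [Hn Hmon]] ->]]].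
  destruct (Hpoly n pp H0 Hmon ltac:(lra)) as [_ ->].
  rewrite Hn, Hzd, Rabs_minus_sym by lra. lra.
Qed.

Lemma arclength_lipschitz g : arclength_param g ->
  forall x y, dist2 (g x) (g y) <= Rabs (x - y).
Proof.
intros H.
assert (Main : forall x y, x <= y -> dist2 (g y) (g x) <= y - x).
{ intros x y Hxy. destruct (H x y Hxy) as [Hub _].
  apply Hub. exists (fun i => match i with O => x | _ => y end), 1%nat.
  split; [|simpl; ring].
  split; [trivial|]. split; [trivial|]. intros i Hi.
  assert (i = 0)%nat by lia; subst; simpl; trivial. }
intros x y. destruct (Rle_dec x y).
- rewrite dist2_sym, Rabs_minus_sym, Rabs_right by lra. apply Main; lra.
- rewrite Rabs_right by lra. apply Main; lra.
Qed.

Lemma reduce_mod (L s : R) : 0 < L -> exists k : Z, 0 <= s - IZR k * L < L.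
Proof.
intros HL. exists (up (s / L) - 1)%Z. rewrite minus_IZR.
destruct (archimed (s / L)) as [H1 H2].
assert (E : s / L * L = s) by (field; lra).
split; nra.
Qed.

Lemma closed_curve_injective_mod g L : closed_convex_curve g L -> injective_mod g L.
Proof.
intros [HL [_ [Hper [Hinj _]]]].
assert (Hn : forall n x, g (x + INR n * L) = g x).
{ induction n as [|n IH]; intros x; [simpl; f_equal; ring|].
  rewrite S_INR. replace (x + (INR n + 1) * L) with (x + INR n * L + L) by ring.
  now rewrite Hper. }
assert (Hz : forall k x, g (x - IZR k * L) = g x).
{ intros k x. destruct (Z.le_gt_cases 0 k) as [Hk|Hk].
  - rewrite <- (Hn (Z.to_nat k)), INR_IZR_INZ, Z2Nat.id by trivial. f_equal; ring.
  - rewrite <- (Hn (Z.to_nat (- k)) x), INR_IZR_INZ, Z2Nat.id by lia.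
    rewrite opp_IZR. f_equal; ring. }
intros s t Hst HtL E.
destruct (reduce_mod L s HL) as [k Hk].
assert (E' : g (s - IZR k * L) = g (t - IZR k * L)) by now rewrite !Hz.
destruct (Rlt_dec (t - IZR k * L) L) as [H|H].
- assert (s - IZR k * L = t - IZR k * L) by (apply Hinj; trivial; lra). lra.
- rewrite <- (Hz 1%Z (t - IZR k * L)) in E'. rewrite Rmult_1_l in E'.
  assert (s - IZR k * L = t - IZR k * L - L) by (apply Hinj; trivial; lra). lra.
Qed.

(** If all points of the interval were exceptional, a constant function would have to grow at rate
    [1]. *)
Lemma null_set_no_interval E a b : null_set E -> a < b -> ~ (forall x, a <= x <= b -> E x).
Proof.
intros HE Hab H.
assert (1 * (b - a) <= 0 - 0); [|lra].
apply (monotone_growth (fun _ => 0) E); trivial; try (intros; lra).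
intros q Hq Hn. now destruct (Hn (H q Hq)).
Qed.

Lemma not_locally_straight g L kappa t : closed_convex_curve g L -> 0 < kappa ->
  null_set (fun s => ~ arc_chord_curv_ge g L (g s) kappa) -> ~ locally_straight g t.
Proof.
intros Hg Hk Hnull [p [q [h [Hpq [Hh Hline]]]]].
assert (Hinj := closed_curve_injective_mod g L Hg).
destruct Hg as [HL [Harc _]].
assert (Hlip := arclength_lipschitz g Harc).
set (h' := Rmin (h / 2) (L / 4)).
assert (Hh' : 0 < h' /\ h' <= h / 2 /\ h' <= L / 4).
{ repeat split; [apply Rmin_glb_lt; lra|apply Rmin_l|apply Rmin_r]. }
assert (Hk0 : forall a b, t - h' <= a -> a < b -> b <= t + h' -> kappa0_arc g a b = 0).
{ intros a b Ha Hab Hb. unfold kappa0_arc.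
  rewrite (straight_arc_chord g L p q a b); trivial; try lra.
  - apply kappa0_segment; lra.
  - intros r Hr. apply Hline. apply Rabs_def1; lra. }
apply (null_set_no_interval _ (t - h' / 2) (t + h' / 2) Hnull); [lra|].
intros r Hr.
assert (Hsmall : forall d, 0 < d -> exists b, r < b /\ b - r < L /\ b - r < d /\
  kappa0_arc g r b = 0 /\ arc_contains g r b (g r)).
{ intros d Hd. exists (r + Rmin (h' / 2) (d / 2)).
  assert (0 < Rmin (h' / 2) (d / 2)) by (apply Rmin_glb_lt; lra).
  assert (A := Rmin_l (h' / 2) (d / 2)). assert (B := Rmin_r (h' / 2) (d / 2)).
  repeat split; try lra; [apply Hk0; lra|exists r; split; [lra|trivial]]. }
intros [[v [Hv Hkv]]|Hinf].
- destruct (Hv kappa Hk) as [d [Hd H]].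
  destruct (Hsmall d Hd) as [b [B1 [B2 [B3 [B4 B5]]]]].
  assert (H' := H r b B1 B2 B3 B5). rewrite B4 in H'. apply Rabs_def2 in H'. lra.
- destruct (Hinf 0) as [d [Hd H]].
  destruct (Hsmall d Hd) as [b [B1 [B2 [B3 [B4 B5]]]]].
  assert (H' := H r b B1 B2 B3 B5). rewrite B4 in H'. lra.
Qed.

Lemma collinear_lerp p q r : p <> r -> orient p q r = 0 -> exists l, q = lerp l p r.
Proof.
intros Hn H. assert (HD := dist2_pos p r Hn). assert (HD2 := dist2_sqr p r).
set (l := ((fst q - fst p) * (fst r - fst p) + (snd q - snd p) * (snd r - snd p)) / dist2 p r ^ 2).
assert (Hl : l * dist2 p r ^ 2
    = (fst q - fst p) * (fst r - fst p) + (snd q - snd p) * (snd r - snd p))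
  by (unfold l; field; lra).
exists l. clearbody l. unfold orient in H.
rewrite (surjective_pairing q). unfold lerp.
assert (HD0 : dist2 p r ^ 2 <> 0) by nra.
f_equal; apply Rmult_eq_reg_r with (dist2 p r ^ 2); trivial.
- transitivity (fst p * dist2 p r ^ 2 + l * dist2 p r ^ 2 * (fst r - fst p)); [|ring].
  rewrite Hl, HD2.
  apply Rminus_diag_uniq.
  transitivity ((snd r - snd p) *
    ((fst q - fst p) * (snd r - snd p) - (snd q - snd p) * (fst r - fst p))); [ring|].
  rewrite H; ring.
- transitivity (snd p * dist2 p r ^ 2 + l * dist2 p r ^ 2 * (snd r - snd p)); [|ring].
  rewrite Hl, HD2.
  apply Rminus_diag_uniq.
  transitivity (- (fst r - fst p) *
    ((fst q - fst p) * (snd r - snd p) - (snd q - snd p) * (fst r - fst p))); [ring|].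
  rewrite H; ring.
Qed.

Lemma orient_neq_0 g L kappa s t u : closed_convex_curve g L -> 0 < kappa ->
  null_set (fun s => ~ arc_chord_curv_ge g L (g s) kappa) ->
  s < t -> t < u -> u < s + L -> orient (g s) (g t) (g u) <> 0.
Proof.
intros Hg Hk Hnull Hst Htu HuL E.
assert (Hinj := closed_curve_injective_mod g L Hg).
assert (Hns := fun r => not_locally_straight g L kappa r Hg Hk Hnull).
destruct Hg as [HL [Harc [_ [_ [K [HK Hbd]]]]]].
assert (Hlip := arclength_lipschitz g Harc).
assert (Hb : forall r, boundary K (g r)) by (intros r; apply Hbd; now exists r).
assert (Hmid : forall x y z l, 0 < l < 1 -> g x <> g z -> g y <> lerp l (g x) (g z)).
{ intros x y z l Hl Hxz Hy. apply (Hns y).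
  now apply (collinear_locally_straight K g x y z l). }
assert (N1 := Hinj s t ltac:(lra) ltac:(lra)).
assert (N2 := Hinj t u ltac:(lra) ltac:(lra)).
assert (N3 := Hinj s u ltac:(lra) ltac:(lra)).
destruct (collinear_lerp _ _ _ N3 E) as [l Hl].
assert (L0 : l <> 0).
{ intros ->. apply N1. rewrite Hl. unfold lerp. rewrite (surjective_pairing (g s)) at 1.
  f_equal; ring. }
assert (L1 : l <> 1).
{ intros ->. apply N2. rewrite Hl. unfold lerp. rewrite (surjective_pairing (g u)) at 3.
  f_equal; ring. }
(* The position of [l] relative to [0] and [1] tells which point lies between the other two; it need
   not be the one with the middle parameter. The new coefficients solve the same affine relation for
   that point. *)
destruct (Rlt_dec l 0) as [C|C]; [|destruct (Rlt_dec 1 l) as [C'|C']].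
- apply (Hmid t s u (- l / (1 - l))); trivial.
  + split; apply Rmult_lt_reg_r with (1 - l); try lra;
      unfold Rdiv; rewrite Rmult_assoc, Rinv_l; lra.
  + rewrite Hl. unfold lerp; simpl. rewrite (surjective_pairing (g s)) at 1.
    f_equal; field; lra.
- apply (Hmid s u t (1 / l)); trivial.
  + split; apply Rmult_lt_reg_r with l; try lra;
      unfold Rdiv; rewrite Rmult_assoc, Rinv_l; lra.
  + rewrite Hl. unfold lerp; simpl. rewrite (surjective_pairing (g u)) at 1.
    f_equal; field; lra.
- apply (Hmid s t u l); trivial. lra.
Qed.

(** The parameter triples [s < t < u < s + L] form a convex set. *)
Lemma orient_constant_sign g L :
  (forall x y, dist2 (g x) (g y) <= Rabs (x - y)) ->
  (forall s t u, s < t -> t < u -> u < s + L -> orient (g s) (g t) (g u) <> 0) ->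
  (forall s t u, s < t -> t < u -> u < s + L -> 0 < orient (g s) (g t) (g u)) \/
  (forall s t u, s < t -> t < u -> u < s + L -> orient (g s) (g t) (g u) < 0).
Proof.
intros Hlip Hne.
assert (Hc1 : continuity (fun x => fst (g x))).
{ apply lipschitz_continuity with 1; [lra|]. intros x y. rewrite Rmult_1_l.
  apply Rle_trans with (2 := Hlip x y). apply Rnot_lt_le; intros H.
  apply dist2_near in H. destruct H as [H _]. rewrite Rabs_minus_sym in H. lra. }
assert (Hc2 : continuity (fun x => snd (g x))).
{ apply lipschitz_continuity with 1; [lra|]. intros x y. rewrite Rmult_1_l.
  apply Rle_trans with (2 := Hlip x y). apply Rnot_lt_le; intros H.
  apply dist2_near in H. destruct H as [_ H]. rewrite Rabs_minus_sym in H. lra. }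
apply NNPP; intros Hn. apply not_or_and in Hn as [Hn1 Hn2].
apply not_all_ex_not in Hn1 as [s1 Hn1]. apply not_all_ex_not in Hn1 as [t1 Hn1].
apply not_all_ex_not in Hn1 as [u1 Hn1].
apply not_all_ex_not in Hn2 as [s2 Hn2]. apply not_all_ex_not in Hn2 as [t2 Hn2].
apply not_all_ex_not in Hn2 as [u2 Hn2].
apply imply_to_and in Hn1 as [A1 Hn1]. apply imply_to_and in Hn1 as [A2 Hn1].
apply imply_to_and in Hn1 as [A3 Hn1].
apply imply_to_and in Hn2 as [B1 Hn2]. apply imply_to_and in Hn2 as [B2 Hn2].
apply imply_to_and in Hn2 as [B3 Hn2].
assert (Haff : forall f x y, continuity f -> continuity (fun l => f ((1 - l) * x + l * y))).
{ intros f x y Hf.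
  apply (continuity_comp (fun l => (1 - l) * x + l * y) f); trivial.
  apply derivable_continuous. intros l. reg. }
destruct (IVT_cor (fun l => orient (g ((1 - l) * s1 + l * s2)) (g ((1 - l) * t1 + l * t2))
    (g ((1 - l) * u1 + l * u2))) 0 1) as [l [Hl El]].
- unfold orient.
  apply continuity_minus; apply continuity_mult; apply continuity_minus;
    apply (Haff (fun x => fst (g x))) || apply (Haff (fun x => snd (g x))); trivial.
- lra.
- replace ((1 - 0) * s1 + 0 * s2) with s1 by ring.
  replace ((1 - 0) * t1 + 0 * t2) with t1 by ring.
  replace ((1 - 0) * u1 + 0 * u2) with u1 by ring.
  replace ((1 - 1) * s1 + 1 * s2) with s2 by ring.
  replace ((1 - 1) * t1 + 1 * t2) with t2 by ring.
  replace ((1 - 1) * u1 + 1 * u2) with u2 by ring. nra.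
- apply (Hne ((1 - l) * s1 + l * s2) ((1 - l) * t1 + l * t2) ((1 - l) * u1 + l * u2)); trivial;
    destruct (Req_dec l 0) as [->|]; nra.
Qed.

(** * Turning near a point of given arc/chord curvature *)

Lemma Rle_div_mult x a b : 0 < b -> x <= a / b -> x * b <= a.
Proof.
intros Hb H. apply Rmult_le_compat_r with (r := b) in H; [|lra].
replace (a / b * b) with a in H by (field; lra). trivial.
Qed.

(** With [x = kappa0 l c * l / 2], the ratio [c / l] is [1 - x ^ 2 / 6] up to fourth order, whence
    the coefficient [v ^ 2 / 24]. *)
Lemma chord_asymptotics v eps : 0 <= v -> 0 < eps ->
  exists e d, 0 < e /\ 0 < d /\ forall l c, 0 < l < d -> 0 < c <= l ->
    Rabs (kappa0 l c - v) < e ->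
    Rabs (c - l * (1 - v ^ 2 / 24 * l ^ 2)) <= eps * l ^ 3.
Proof.
intros Hv Heps.
set (e := Rmin 1 (eps / (2 * v + 1))).
assert (He : 0 < e) by (apply Rmin_glb_lt; [lra|apply Rdiv_lt_0_compat; lra]).
assert (He1 : e <= 1) by apply Rmin_l.
assert (He2 : e * (2 * v + 1) <= eps) by (apply Rle_div_mult; [lra|apply Rmin_r]).
assert (HV : 0 < (v + 1) ^ 4) by (apply pow_lt; lra).
set (d := Rmin 1 (eps / (v + 1) ^ 4)).
assert (Hd : 0 < d) by (apply Rmin_glb_lt; [lra|apply Rdiv_lt_0_compat; lra]).
assert (Hd1 : d <= 1) by apply Rmin_l.
assert (Hd2 : d * (v + 1) ^ 4 <= eps) by (apply Rle_div_mult; [lra|apply Rmin_r]).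
exists e, d. split; trivial. split; trivial.
intros l c Hl Hc Hk. apply Rabs_def2 in Hk.
destruct (kappa0_chord_bounds l c ltac:(lra) Hc) as [Hx [B1 B2]].
set (k := kappa0 l c) in *.
assert (Hk0 : 0 <= k) by nra.
assert (Hkk : - eps <= k ^ 2 - v ^ 2 <= eps).
{ replace (k ^ 2 - v ^ 2) with ((k - v) * (k + v)) by ring. split; nra. }
assert (Hl3 : 0 < l ^ 3) by (apply pow_lt; lra).
assert (H4 : k ^ 4 * l ^ 2 <= eps).
{ apply Rle_trans with ((v + 1) ^ 4 * d); [|lra].
  apply Rmult_le_compat; [apply pow_le; lra|apply pow_le; lra| |nra].
  apply pow_incr; lra. }
replace ((k * l / 2) ^ 2) with (k ^ 2 * l ^ 2 / 4) in * by field.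
replace ((k * l / 2) ^ 4) with (k ^ 4 * l ^ 2 * l ^ 2 / 16) in * by field.
apply Rabs_le. split.
- apply Rle_trans with (l * (1 - k ^ 2 * l ^ 2 / 4 / 6) - l * (1 - v ^ 2 / 24 * l ^ 2)); [|lra].
  replace (l * (1 - k ^ 2 * l ^ 2 / 4 / 6) - l * (1 - v ^ 2 / 24 * l ^ 2))
    with (- (k ^ 2 - v ^ 2) / 24 * l ^ 3) by field. nra.
- apply Rle_trans with (l * (1 - k ^ 2 * l ^ 2 / 4 / 6 + k ^ 4 * l ^ 2 * l ^ 2 / 16 / 120)
    - l * (1 - v ^ 2 / 24 * l ^ 2)); [lra|].
  replace (_ - _) with ((- (k ^ 2 - v ^ 2) / 24 + k ^ 4 * l ^ 2 / 1920) * l ^ 3) by field. nra.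
Qed.

(** Everything is scaled by [h]: [a0], [a1], [a2] stand for chord lengths over [h], [T2] for the
    square of [sin (phi / 2) / h], and [mu] bounds the relative gap between chord and arc. Replacing
    the chords by [1 + rho], [rho], [1] gives the main term. *)
Lemma half_angle_square_estimate w rho mu eps E a0 a1 a2 T2 :
  0 <= w -> 1 / 2 <= rho <= 1 -> 0 <= mu <= 1 / 4 -> 0 <= eps <= 1 ->
  rho * (1 - mu) <= a1 <= rho -> 1 - mu <= a2 <= 1 ->
  (1 + rho) * (1 - mu) <= a0 <= 1 + rho -> - (10 * eps) <= E <= 10 * eps ->
  4 * a1 * a2 * T2 = (3 * w * rho * (1 + rho) + E) * (a0 + a1 + a2) -> 0 <= T2 ->
  Rabs (T2 - 3 * w * (1 + rho) ^ 2 / 2) <= 20 * eps + mu * (30 * w + 80).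
Proof.
intros Hw Hrho Hmu Heps H1 H2 H0 HE Heq HT.
set (T0 := 3 * w * (1 + rho) ^ 2 / 2).
assert (HT0 : 0 <= T0 <= 6 * w).
{ unfold T0. assert (1 <= (1 + rho) ^ 2 <= 4) by nra. nra. }
set (F := 3 * w * rho * (1 + rho)) in *.
assert (HF : F * (2 * (1 + rho)) = 4 * rho * T0) by (unfold F, T0; field).
assert (HF0 : 0 <= F) by (unfold F; repeat apply Rmult_le_pos; lra).
assert (Ha1 : 0 <= rho * (1 - mu)) by (apply Rmult_le_pos; lra).
assert (Ha : 0 <= 4 * a1 * a2 <= 4 * rho).
{ assert (0 <= a1 * a2) by (apply Rmult_le_pos; lra). assert (a1 * a2 <= rho * 1) by (apply Rmult_le_compat; lra). lra. }
assert (Ha' : 4 * rho * (1 - 2 * mu) <= 4 * a1 * a2).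
{ assert (rho * (1 - mu) * (1 - mu) <= a1 * a2) by (apply Rmult_le_compat; lra).
  assert (0 <= rho * (mu * mu)) by nra. lra. }
set (s := a0 + a1 + a2) in *.
assert (Hs : 2 * (1 + rho) * (1 - mu) <= s <= 2 * (1 + rho)) by (unfold s; lra).
clearbody s F T0.
apply Rabs_le. split.
- assert (4 * rho * T2 >= F * (2 * (1 + rho)) * (1 - mu) - 10 * eps * (2 * (1 + rho))).
  { apply Rle_ge. apply Rle_trans with (4 * a1 * a2 * T2); [|apply Rmult_le_compat_r; lra].
    rewrite Heq.
    assert (F * (2 * (1 + rho) * (1 - mu)) <= F * s) by (apply Rmult_le_compat_l; lra).
    assert (- (10 * eps * (2 * (1 + rho))) <= E * s) by nra. lra. }
  rewrite HF in H.
  assert (rho * T2 >= rho * (T0 * (1 - mu)) - rho * (20 * eps)) by nra.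
  assert (T2 >= T0 * (1 - mu) - 20 * eps) by nra. nra.
- assert (4 * rho * (1 - 2 * mu) * T2 <= 4 * rho * T0 + 10 * eps * (2 * (1 + rho))).
  { apply Rle_trans with (4 * a1 * a2 * T2); [apply Rmult_le_compat_r; lra|].
    rewrite Heq, <- HF.
    assert (F * s <= F * (2 * (1 + rho))) by (apply Rmult_le_compat_l; lra).
    assert (E * s <= 10 * eps * (2 * (1 + rho))) by nra. lra. }
  assert (rho * ((1 - 2 * mu) * T2) <= rho * (T0 + 20 * eps)) by nra.
  assert (Hu : (1 - 2 * mu) * T2 <= T0 + 20 * eps) by nra.
  assert (T2 <= 12 * w + 40) by nra. nra.
Qed.

(** The cosine law reads [4 * c1 * c2 * sin (phi / 2) ^ 2 = (c1 + c2 - c0) * (c0 + c1 + c2)]. In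
    [c1 + c2 - c0] the linear parts cancel and the cubic parts leave [3 * w * h * s * (h + s)]; this
    is why chords must be known up to [o(h ^ 3)]. *)
Lemma angle_from_chords v eps : 0 < v -> 0 < eps ->
  exists e d, 0 < e /\ 0 < d /\ forall h s c0 c1 c2 phi, 0 < h < d -> h / 2 <= s <= h ->
    Rabs (c1 - s * (1 - v ^ 2 / 24 * s ^ 2)) <= e * s ^ 3 ->
    Rabs (c2 - h * (1 - v ^ 2 / 24 * h ^ 2)) <= e * h ^ 3 ->
    Rabs (c0 - (h + s) * (1 - v ^ 2 / 24 * (h + s) ^ 2)) <= e * (h + s) ^ 3 ->
    c1 <= s -> c2 <= h -> c0 <= h + s -> 0 <= phi <= PI ->
    c0 ^ 2 = c1 ^ 2 + c2 ^ 2 + 2 * c1 * c2 * cos phi ->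
    Rabs (phi - v * (h + s) / 2) <= eps * h.
Proof.
intros Hv Heps.
set (w := v ^ 2 / 24). assert (Hw : 0 < w) by (unfold w; nra).
set (e := Rmin 1 (eps * v / 480)).
assert (He : 0 < e) by (apply Rmin_glb_lt; [lra|nra]).
assert (He1 : e <= 1) by apply Rmin_l.
assert (He2 : e <= eps * v / 480) by apply Rmin_r.
set (B := 30 * w + 80). assert (HB : 80 < B) by (unfold B; lra).
set (V := v / 2 + eps + 1). assert (HV : 1 < V) by (unfold V; lra).
assert (HV3 : 0 < V ^ 3) by (apply pow_lt; lra).
(* In order: [h ^ 2 <= h]; [mu <= 1 / 4]; [mu * B] at most [eps * v / 24], matching [20 * e]; and a
   bound on the cubic error of sine. *)
set (d := Rmin 1 (Rmin (1 / (16 * (w + 1))) (Rmin (eps * v / (96 * (w + 1) * B)) (eps / (24 * V ^ 3))))).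
assert (Hd : 0 < d).
{ assert (0 < (w + 1) * B) by (apply Rmult_lt_0_compat; lra).
  repeat apply Rmin_glb_lt; try lra; apply Rdiv_lt_0_compat; nra. }
assert (Hd1 : d <= 1) by apply Rmin_l.
assert (Hd2 : d <= 1 / (16 * (w + 1))).
{ apply Rle_trans with (1 := Rmin_r _ _), Rmin_l. }
assert (Hd3 : d <= eps * v / (96 * (w + 1) * B)).
{ apply Rle_trans with (1 := Rmin_r _ _). apply Rle_trans with (1 := Rmin_r _ _), Rmin_l. }
assert (Hd4 : d <= eps / (24 * V ^ 3)).
{ do 3 apply Rle_trans with (1 := Rmin_r _ _). lra. }
exists e, d. split; trivial. split; trivial.
intros h s c0 c1 c2 phi Hh Hs H1 H2 H0 G1 G2 G0 Hphi Hcos.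
apply Rabs_le_bounds in H0, H1, H2.
set (rho := s / h). assert (Hrho : s = rho * h) by (unfold rho; field; lra).
assert (Hr : 1 / 2 <= rho <= 1) by (split; nra).
set (u := h ^ 2). assert (Hu : 0 < u) by (unfold u; nra).
assert (Hud : u <= d) by (unfold u; nra).
set (mu := 4 * (w + 1) * u).
assert (Hmu : 0 <= mu <= 1 / 4).
{ split; [unfold mu; nra|]. unfold mu.
  assert (d * (16 * (w + 1)) <= 1).
  { apply Rle_div_mult; lra. }
  nra. }
assert (HmuB : mu * B <= eps * v / 24).
{ unfold mu. apply Rmult_le_compat_r with (r := 4 * (w + 1) * B) in Hd3; [|nra].
  replace (eps * v / (96 * (w + 1) * B) * (4 * (w + 1) * B)) with (eps * v / 24) in Hd3
    by (field; lra).
  apply Rle_trans with (2 := Hd3).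
  replace (4 * (w + 1) * u * B) with (u * (4 * (w + 1) * B)) by ring.
  apply Rmult_le_compat_r; nra. }
set (a1 := c1 / h). set (a2 := c2 / h). set (a0 := c0 / h).
assert (E1 : c1 = a1 * h) by (unfold a1; field; lra).
assert (E2 : c2 = a2 * h) by (unfold a2; field; lra).
assert (E0 : c0 = a0 * h) by (unfold a0; field; lra).
clearbody a0 a1 a2 rho. subst c0 c1 c2 s.
fold w in H0, H1, H2.
assert (B1 : - (e * rho ^ 3 * u) <= a1 - rho * (1 - w * rho ^ 2 * u) <= e * rho ^ 3 * u).
{ unfold u. split; apply Rmult_le_reg_r with h; try lra. }
assert (B2 : - (e * u) <= a2 - (1 - w * u) <= e * u).
{ unfold u. split; apply Rmult_le_reg_r with h; try lra. }
assert (B0 : - (e * (1 + rho) ^ 3 * u) <= a0 - (1 + rho) * (1 - w * (1 + rho) ^ 2 * u)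
  <= e * (1 + rho) ^ 3 * u).
{ unfold u. split; apply Rmult_le_reg_r with h; try lra. }
assert (U1 : a1 <= rho) by nra.
assert (U2 : a2 <= 1) by nra.
assert (U0 : a0 <= 1 + rho) by nra.
assert (R3 : rho ^ 3 <= 1 /\ 0 < rho ^ 3 /\ rho ^ 2 <= 1 /\ rho ^ 3 = rho * rho ^ 2).
{ assert (rho ^ 2 <= 1) by nra. assert (0 < rho ^ 2) by nra.
  replace (rho ^ 3) with (rho * rho ^ 2) by ring. repeat split; nra. }
assert (Q3 : (1 + rho) ^ 2 <= 4 /\ 0 < (1 + rho) ^ 2 /\ (1 + rho) ^ 3 = (1 + rho) * (1 + rho) ^ 2).
{ repeat split; nra. }
assert (Heu : 0 < e * u) by nra.
assert (Hwu : 0 < w * u) by nra.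
assert (L1 : rho * (1 - mu) <= a1).
{ unfold mu. destruct R3 as [R1 [R2 [R4 R5]]]. rewrite R5 in B1.
  assert (rho * (rho ^ 2 * ((w + e) * u)) <= rho * (4 * (w + 1) * u)).
  { apply Rmult_le_compat_l; [lra|].
    apply Rle_trans with (1 * ((w + e) * u)); [apply Rmult_le_compat_r; nra|]. nra. }
  lra. }
assert (L2 : 1 - mu <= a2) by (unfold mu; nra).
assert (L0 : (1 + rho) * (1 - mu) <= a0).
{ unfold mu. destruct Q3 as [R1 [R2 R5]]. rewrite R5 in B0.
  assert ((1 + rho) * ((1 + rho) ^ 2 * ((w + e) * u)) <= (1 + rho) * (4 * (w + 1) * u)).
  { apply Rmult_le_compat_l; [lra|].
    apply Rle_trans with (4 * ((w + e) * u)); [apply Rmult_le_compat_r; nra|]. nra. }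
  lra. }
set (E := (a1 + a2 - a0) / u - 3 * w * rho * (1 + rho)).
assert (HE : (a1 + a2 - a0) = (3 * w * rho * (1 + rho) + E) * u)
  by (unfold E; field; lra).
assert (HE10 : - (10 * e) <= E <= 10 * e).
{ assert (- (10 * e) * u <= E * u <= 10 * e * u).
  { replace (E * u) with (a1 + a2 - a0 - 3 * w * rho * (1 + rho) * u) by (rewrite HE; ring).
    assert (0 <= e * rho ^ 3 * u <= e * u) by (split; nra).
    assert (0 <= e * (1 + rho) ^ 3 * u <= 8 * e * u).
    { destruct Q3 as [R1 [R2 R5]].
      assert (0 <= (1 + rho) ^ 3 <= 8) by (rewrite R5; nra).
      split; nra. }
    lra. }
  split; nra. }
set (S := sin (phi / 2)).
assert (HS0 : 0 <= S) by (apply sin_ge_0; lra).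
assert (HcS : cos phi = 1 - 2 * S * S).
{ unfold S. rewrite <- cos_2a_sin. f_equal; lra. }
set (T := S / h). assert (HT : S = T * h) by (unfold T; field; lra).
assert (HT0 : 0 <= T) by nra.
assert (HTeq : 4 * a1 * a2 * T ^ 2 = (3 * w * rho * (1 + rho) + E) * (a0 + a1 + a2)).
{ apply Rmult_eq_reg_r with u; [|lra].
  transitivity ((a1 + a2 - a0) * (a0 + a1 + a2)); [|rewrite HE; ring].
  assert (Hc' : a0 ^ 2 = a1 ^ 2 + a2 ^ 2 + 2 * a1 * a2 * cos phi).
  { apply Rmult_eq_reg_r with (h ^ 2); [|fold u; lra]. lra. }
  rewrite HcS, HT in Hc'. unfold u. lra. }
assert (HTe := half_angle_square_estimate w rho mu e E a0 a1 a2 (T ^ 2) ltac:(lra) Hr Hmu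
  ltac:(lra) ltac:(lra) ltac:(lra) ltac:(lra) HE10 HTeq ltac:(nra)).
fold B in HTe.
(* As [w = v ^ 2 / 24], the main term is a perfect square, and the difference of squares can be
   divided by [T + T0], which is at least [3 * v / 8]. *)
set (T0 := v * (1 + rho) / 4).
assert (HT02 : 3 * w * (1 + rho) ^ 2 / 2 = T0 ^ 2) by (unfold w, T0; field).
rewrite HT02 in HTe.
assert (HT0l : 3 * v / 8 <= T0 <= v / 2) by (unfold T0; split; nra).
assert (HTT : Rabs (T - T0) <= eps / 4).
{ assert (Hd' : Rabs (T ^ 2 - T0 ^ 2) <= eps * v / 12) by lra.
  replace (T ^ 2 - T0 ^ 2) with ((T - T0) * (T + T0)) in Hd' by ring.
  rewrite Rabs_mult, (Rabs_right (T + T0)) in Hd' by lra.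
  assert (HA := Rabs_pos (T - T0)).
  assert (Rabs (T - T0) * (3 * v / 8) <= eps * v / 12) by nra.
  apply Rmult_le_reg_r with v; nra. }
apply Rabs_le_bounds in HTT.
assert (Hsin1 : S <= phi / 2) by (apply sin_le_id; lra).
assert (Hsin2 := sin_ge_cubic (phi / 2) ltac:(lra)). fold S in Hsin2.
assert (HP4 := PI_4).
(* For [z <= 2] the cubic bound gives [z / 3 <= sin z]. So [phi / 2] is of order [h] and differs
   from its sine only by order [h ^ 3]. *)
assert (Hphi2 : phi / 2 <= 3 * S).
{ assert (Hz : 0 <= phi / 2 <= 2) by lra.
  revert Hsin2 Hz. generalize (phi / 2). intros z Hz2 Hz.
  assert (z ^ 2 <= 4) by (replace 4 with (2 ^ 2) by ring; apply pow_incr; lra).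
  assert (z * z ^ 2 <= z * 4) by (apply Rmult_le_compat_l; lra). lra. }
assert (HS3 : (phi / 2) ^ 3 <= 27 * S ^ 3).
{ replace (27 * S ^ 3) with ((3 * S) ^ 3) by ring. apply pow_incr; lra. }
assert (HTV : T ^ 3 <= V ^ 3) by (apply pow_incr; unfold V; lra).
assert (Hd4' : u * V ^ 3 <= eps / 24).
{ assert (d * (24 * V ^ 3) <= eps) by (apply Rle_div_mult; lra).
  assert (u * V ^ 3 <= d * V ^ 3) by (apply Rmult_le_compat_r; lra). lra. }
assert (HSh : S ^ 3 <= eps / 24 * h).
{ rewrite HT. replace ((T * h) ^ 3) with (T ^ 3 * u * h) by (unfold u; ring).
  apply Rmult_le_compat_r; [lra|].
  assert (T ^ 3 * u <= V ^ 3 * u) by (apply Rmult_le_compat_r; lra). lra. }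
replace (v * (h + rho * h) / 2) with (2 * T0 * h) by (unfold T0; field).
assert (h * (- (eps / 4)) <= h * (T - T0) <= h * (eps / 4)) by (split; apply Rmult_le_compat_l; lra).
apply Rabs_le. lra.
Qed.

(** [c x y] and [A x y] are the length and the polar angle of the chord from
    the point at [x] to the point at [y]; [th x] is the angle of a tangent at [x]. *)
Record chord_angles (c A : R -> R -> R) (th : R -> R) (lo hi : R) : Prop := {
  ca_length : forall x y, lo < x -> x < y -> y < hi -> 0 < c x y <= y - x;
  ca_cos : forall x y z, lo < x -> x < y -> y < z -> z < hi ->
    c x z * cos (A x z) = c x y * cos (A x y) + c y z * cos (A y z);
  ca_sin : forall x y z, lo < x -> x < y -> y < z -> z < hi ->
    c x z * sin (A x z) = c x y * sin (A x y) + c y z * sin (A y z);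
  ca_mono : forall x y z, lo < x -> x < y -> y < z -> z < hi ->
    A x y <= A x z <= A y z /\ A y z <= A x y + PI;
  ca_tangent : forall x y, lo < x -> x < y -> y < hi -> th x <= A x y <= th y }.

Definition chord_curv_near (c : R -> R -> R) (lo hi q v : R) : Prop :=
  forall e, 0 < e -> exists d, 0 < d /\ forall x y, lo < x -> x <= q -> q <= y -> y < hi ->
    x < y -> y - x < d -> Rabs (kappa0 (y - x) (c x y) - v) < e.

(** Reversal of the parameter combined with a reflection negates angles. The record bounds only
    differences of angles, so the negated ones still fit, and left-sided estimates follow from
    right-sided ones. *)
Lemma chord_angles_mirror c A th lo hi : chord_angles c A th lo hi ->
  chord_angles (fun x y => c (- y) (- x)) (fun x y => - A (- y) (- x))
    (fun x => - th (- x)) (- hi) (- lo).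
Proof.
intros [H1 H2 H3 H4 H5]. constructor.
- intros x y Hx Hxy Hy. generalize (H1 (- y) (- x) ltac:(lra) ltac:(lra) ltac:(lra)). lra.
- intros x y z Hx Hxy Hyz Hz. rewrite !cos_neg.
  generalize (H2 (- z) (- y) (- x) ltac:(lra) ltac:(lra) ltac:(lra) ltac:(lra)). lra.
- intros x y z Hx Hxy Hyz Hz. rewrite !sin_neg.
  generalize (H3 (- z) (- y) (- x) ltac:(lra) ltac:(lra) ltac:(lra) ltac:(lra)). lra.
- intros x y z Hx Hxy Hyz Hz.
  generalize (H4 (- z) (- y) (- x) ltac:(lra) ltac:(lra) ltac:(lra) ltac:(lra)). lra.
- intros x y Hx Hxy Hy. generalize (H5 (- y) (- x) ltac:(lra) ltac:(lra) ltac:(lra)). lra.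
Qed.

Lemma chord_curv_near_mirror c lo hi q v : chord_curv_near c lo hi q v ->
  chord_curv_near (fun x y => c (- y) (- x)) (- hi) (- lo) (- q) v.
Proof.
intros H e He. destruct (H e He) as [d [Hd H']]. exists d. split; trivial.
intros x y Hx Hxq Hqy Hy Hxy Hd'. replace (y - x) with (- x - - y) by ring.
apply H'; lra.
Qed.

Lemma chord_cosine_law c A th lo hi x y z : chord_angles c A th lo hi ->
  lo < x -> x < y -> y < z -> z < hi ->
  c x z ^ 2 = c y z ^ 2 + c x y ^ 2 + 2 * c y z * c x y * cos (A y z - A x y).
Proof.
intros H Hx Hxy Hyz Hz.
assert (E1 := ca_cos _ _ _ _ _ H x y z Hx Hxy Hyz Hz).
assert (E2 := ca_sin _ _ _ _ _ H x y z Hx Hxy Hyz Hz).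
assert (S := fun t => sin2_cos2 t). unfold Rsqr in S.
rewrite cos_minus.
transitivity ((c x z * cos (A x z)) ^ 2 + (c x z * sin (A x z)) ^ 2).
- transitivity (c x z ^ 2 * (sin (A x z) * sin (A x z) + cos (A x z) * cos (A x z))).
  + rewrite S; ring.
  + ring.
- rewrite E1, E2.
  transitivity (c y z ^ 2 * (sin (A y z) * sin (A y z) + cos (A y z) * cos (A y z))
   + c x y ^ 2 * (sin (A x y) * sin (A x y) + cos (A x y) * cos (A x y))
   + 2 * c y z * c x y * (cos (A y z) * cos (A x y) + sin (A y z) * sin (A x y))); [ring|].
  rewrite !S; ring.
Qed.

Lemma chord_sine_law c A th lo hi x y z : chord_angles c A th lo hi ->
  lo < x -> x < y -> y < z -> z < hi ->
  c x z * sin (A x z - A x y) = c y z * sin (A y z - A x y).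
Proof.
intros H Hx Hxy Hyz Hz.
assert (E1 := ca_cos _ _ _ _ _ H x y z Hx Hxy Hyz Hz).
assert (E2 := ca_sin _ _ _ _ _ H x y z Hx Hxy Hyz Hz).
rewrite !sin_minus.
transitivity ((c x z * sin (A x z)) * cos (A x y) - (c x z * cos (A x z)) * sin (A x y)); [ring|].
rewrite E1, E2. ring.
Qed.

Lemma exists_pow_half_le eps : 0 < eps -> exists n, (1 / 2) ^ n <= eps.
Proof.
intros He. destruct (pow_lt_1_zero (1 / 2) ltac:(rewrite Rabs_right; lra) eps He) as [n Hn].
exists n. generalize (Hn n (le_n n)). generalize (Rle_abs ((1 / 2) ^ n)). lra.
Qed.

Section RightTurning.

Variables (c A : R -> R -> R) (th : R -> R) (lo hi q v : R).
Hypothesis Hca : chord_angles c A th lo hi.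
Hypothesis Hq : lo < q < hi.
Hypothesis Hv : 0 < v.
Hypothesis Hcurv : chord_curv_near c lo hi q v.

Lemma chord_angle_estimate eps : 0 < eps ->
  exists d, 0 < d /\ forall h s, 0 < h < d -> h / 2 <= s <= h ->
    lo < q - h /\ q + h < hi /\ h * (1 - eps) <= c q (q + h) /\
    Rabs (A q (q + s) - A (q - h) q - v * (h + s) / 2) <= eps * h.
Proof.
intros Heps.
destruct (angle_from_chords v eps Hv Heps) as [e [d1 [He [Hd1 Hang]]]].
destruct (chord_asymptotics v e ltac:(lra) He) as [e2 [d2 [He2 [Hd2 Hch]]]].
destruct (Hcurv e2 He2) as [d3 [Hd3 Hk]].
set (w := v ^ 2 / 24) in *. assert (Hw : 0 < w) by (unfold w; nra).
(* The arc over [[q - h, q + s]] can be as long as [2 * h], hence the halved bound; [eps / (w + e)]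
   serves the lower bound on the chord. *)
set (d := Rmin (Rmin d1 (Rmin d2 d3 / 2))
   (Rmin (Rmin (q - lo) (hi - q)) (Rmin 1 (eps / (w + e))))).
assert (Hd : 0 < d).
{ assert (0 < Rmin d2 d3) by (apply Rmin_glb_lt; lra).
  unfold d. repeat apply Rmin_glb_lt; try lra. apply Rdiv_lt_0_compat; lra. }
assert (D1 : d <= d1 /\ d <= Rmin d2 d3 / 2 /\ d <= q - lo /\ d <= hi - q /\ d <= 1 /\
   d <= eps / (w + e)).
{ unfold d. repeat split.
  - apply Rle_trans with (1 := Rmin_l _ _), Rmin_l.
  - apply Rle_trans with (1 := Rmin_l _ _), Rmin_r.
  - apply Rle_trans with (1 := Rmin_r _ _). apply Rle_trans with (1 := Rmin_l _ _), Rmin_l.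
  - apply Rle_trans with (1 := Rmin_r _ _). apply Rle_trans with (1 := Rmin_l _ _), Rmin_r.
  - apply Rle_trans with (1 := Rmin_r _ _). apply Rle_trans with (1 := Rmin_r _ _), Rmin_l.
  - apply Rle_trans with (1 := Rmin_r _ _). apply Rle_trans with (1 := Rmin_r _ _), Rmin_r. }
assert (D2 := Rmin_l d2 d3). assert (D3 := Rmin_r d2 d3).
destruct D1 as [D4 [D5 [D6 [D7 [D8 D9]]]]].
apply Rle_div_mult in D9; [|lra].
exists d. split; trivial. intros h s Hh Hs.
assert (Hest : forall x y, q - h <= x -> x <= q -> q <= y -> y <= q + h -> x < y ->
  c x y <= y - x /\ Rabs (c x y - (y - x) * (1 - w * (y - x) ^ 2)) <= e * (y - x) ^ 3).
{ intros x y Hx Hxq Hqy Hy Hxy.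
  assert (Hl := ca_length _ _ _ _ _ Hca x y ltac:(lra) Hxy ltac:(lra)).
  split; [lra|]. apply Hch; try lra. apply Hk; lra. }
destruct (Hest q (q + s)) as [G1 F1]; try lra.
destruct (Hest q (q + h)) as [G3 F3]; try lra.
destruct (Hest (q - h) q) as [G2 F2]; try lra.
destruct (Hest (q - h) (q + s)) as [G0 F0]; try lra.
replace (q + s - q) with s in * by ring.
replace (q + h - q) with h in * by ring.
replace (q - (q - h)) with h in * by ring.
replace (q + s - (q - h)) with (h + s) in * by ring.
split; [lra|]. split; [lra|]. split.
- apply Rabs_le_bounds in F3.
  assert (h ^ 3 * (w + e) <= h * eps); [|lra].
  replace (h ^ 3 * (w + e)) with (h * (h * h * (w + e))) by ring.
  apply Rmult_le_compat_l; [lra|].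
  apply Rle_trans with (d * (w + e)); trivial.
  apply Rmult_le_compat_r; [lra|]. nra.
- apply (Hang h s (c (q - h) (q + s)) (c q (q + s)) (c (q - h) q)); trivial; try lra.
  + assert (M := ca_mono _ _ _ _ _ Hca (q - h) q (q + s) ltac:(lra) ltac:(lra) ltac:(lra) ltac:(lra)).
    lra.
  + apply (chord_cosine_law c A th lo hi); trivial; lra.
Qed.

(** Dyadic telescoping: the estimate controls [A q (q + h) - A q (q + h / 2)]
    up to [o(h)], and [th q] bounds all these angles from below. *)
Lemma chord_angle_from_tangent eps : 0 < eps ->
  exists d, 0 < d /\ forall h, 0 < h < d -> th q + (v / 2 - 5 * eps) * h <= A q (q + h).
Proof.
intros Heps.
destruct (chord_angle_estimate eps Heps) as [d [Hd Hest]].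
exists d. split; trivial.
(* Subtracting the estimates for [s = h / 2] and [s = h] gains [v * h / 4 - 2 * eps * h] per
   halving; the geometric sum produces the factor [1 - (1 / 2) ^ n]. *)
assert (Hind : forall n h, 0 < h < d ->
  th q + (v / 2 - 4 * eps) * h * (1 - (1 / 2) ^ n) <= A q (q + h)).
{ induction n as [|n IH]; intros h Hh.
  - destruct (Hest h h Hh ltac:(lra)) as [H1 [H2 _]].
    assert (H := ca_tangent _ _ _ _ _ Hca q (q + h) ltac:(lra) ltac:(lra) ltac:(lra)).
    simpl; lra.
  - specialize (IH (h / 2) ltac:(lra)).
    destruct (Hest h h Hh ltac:(lra)) as [_ [_ [_ F1]]].
    destruct (Hest h (h / 2) Hh ltac:(lra)) as [_ [_ [_ F2]]].
    apply Rabs_le_bounds in F1, F2. simpl. lra. }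
intros h Hh.
destruct (exists_pow_half_le (eps / v) ltac:(apply Rdiv_lt_0_compat; lra)) as [n Hn].
apply Rle_div_mult in Hn; trivial.
assert (0 < (1 / 2) ^ n) by (apply pow_lt; lra).
specialize (Hind n h Hh).
assert (h * ((1 / 2) ^ n * v) <= h * eps) by (apply Rmult_le_compat_l; lra).
assert (0 < eps * h) by (apply Rmult_lt_0_compat; lra).
assert (0 < eps * h * (1 / 2) ^ n) by (repeat apply Rmult_lt_0_compat; lra).
lra.
Qed.

(** In the triangle at [q], [q + s], [q + h] with [s = (1 - eta) * h], the angle [om] at [q] is
    about [v * eta * h / 2], and the side [p] beyond [q + s] is at most [eta * h] by arclength
    alone. The sine law makes the turn [lam] at least about [v * h / 2]; the chord to [q + s] has
    already turned by about [v * s / 2] from [th q]. *)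
Lemma turning_right delta : 0 < delta ->
  exists r, 0 < r /\ forall y, q < y -> y < q + r -> y < hi ->
    (v - delta) * (y - q) <= th y - th q.
Proof.
intros Hdelta.
set (eta := Rmin (1 / 2) (delta / v)).
assert (Heta : 0 < eta) by (apply Rmin_glb_lt; [lra|apply Rdiv_lt_0_compat; lra]).
assert (Heta1 : eta <= 1 / 2) by apply Rmin_l.
assert (Heta2 : eta * v <= delta) by (apply Rle_div_mult; [lra|apply Rmin_r]).
(* Per unit of [h], the final inequality loses at most [eta ^ 2 * v / 2] because [s < h] and at most
   [(8 + v / 2) * eps] in the estimates; each is at most [eta * delta / 2]. *)
set (eps := Rmin 1 (eta * delta / (16 + v))).
assert (Heps : 0 < eps).
{ apply Rmin_glb_lt; [lra|]. apply Rdiv_lt_0_compat; [|lra]. now apply Rmult_lt_0_compat. }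
assert (Heps1 : eps <= 1) by apply Rmin_l.
assert (Heps2 : eps * (16 + v) <= eta * delta) by (apply Rle_div_mult; [lra|apply Rmin_r]).
destruct (chord_angle_estimate eps Heps) as [d1 [Hd1 Hest]].
destruct (chord_angle_from_tangent eps Heps) as [d2 [Hd2 Htan]].
assert (HV : 0 < (v + 2) ^ 3) by (apply pow_lt; lra).
remember ((v + 2) ^ 3) as V eqn:EV.
set (r := Rmin (Rmin d1 d2) (Rmin 1 (eps / V))).
assert (Hr : 0 < r).
{ repeat apply Rmin_glb_lt; try lra. now apply Rdiv_lt_0_compat. }
assert (Hr1 : r <= d1) by (apply Rle_trans with (1 := Rmin_l _ _), Rmin_l).
assert (Hr2 : r <= d2) by (apply Rle_trans with (1 := Rmin_l _ _), Rmin_r).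
assert (Hr3 : r <= 1) by (apply Rle_trans with (1 := Rmin_r _ _), Rmin_l).
assert (Hr4 : r * V <= eps).
{ apply Rle_div_mult; trivial. apply Rle_trans with (1 := Rmin_r _ _), Rmin_r. }
clearbody r eta eps.
exists r. split; trivial. intros y Hqy Hyr Hy.
set (h := y - q). assert (Ey : y = q + h) by (unfold h; ring).
assert (Hh : 0 < h < r) by lra. clearbody h. subst y.
set (s := (1 - eta) * h).
assert (Heh : 0 < eta * h <= h / 2) by (split; nra).
assert (Hs : h / 2 <= s /\ s < h) by (unfold s; lra).
destruct (Hest h s ltac:(lra) ltac:(lra)) as [I1 [I2 [I3 F1]]].
destruct (Hest h h ltac:(lra) ltac:(lra)) as [_ [_ [_ F2]]].
assert (Ht := Htan s ltac:(lra)).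
apply Rabs_le_bounds in F1, F2.
set (om := A q (q + h) - A q (q + s)).
assert (Hom : v * (eta * h) / 2 - 2 * eps * h <= om <= v * (eta * h) / 2 + 2 * eps * h)
  by (unfold om, s in *; lra).
destruct (ca_mono _ _ _ _ _ Hca q (q + s) (q + h) ltac:(lra) ltac:(lra) ltac:(lra) ltac:(lra))
  as [M1 M2].
assert (Hsine := chord_sine_law _ _ _ _ _ q (q + s) (q + h) Hca
  ltac:(lra) ltac:(lra) ltac:(lra) ltac:(lra)).
assert (Hp := ca_length _ _ _ _ _ Hca (q + s) (q + h) ltac:(lra) ltac:(lra) ltac:(lra)).
assert (Hc2 := ca_length _ _ _ _ _ Hca q (q + h) ltac:(lra) ltac:(lra) ltac:(lra)).
assert (Hth := ca_tangent _ _ _ _ _ Hca (q + s) (q + h) ltac:(lra) ltac:(lra) ltac:(lra)).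
fold om in Hsine.
set (lam := A (q + s) (q + h) - A q (q + s)) in *.
replace (q + h - (q + s)) with (eta * h) in Hp by (unfold s; ring).
replace (q + h - q) with h in * by ring.
set (p := c (q + s) (q + h)) in *. set (c2 := c q (q + h)) in *.
assert (Hom0 : 0 <= om <= PI) by (unfold om, lam in *; lra).
assert (Hlam0 : 0 <= lam <= PI) by (unfold lam in *; lra).
assert (Hlam1 : sin lam <= lam) by (apply sin_le_id; lra).
assert (Hlam2 : 0 <= sin lam) by (apply sin_ge_0; lra).
assert (Hom1 := sin_ge_cubic om Hom0).
assert (Hom2 : 0 <= sin om) by (apply sin_ge_0; lra).
assert (Hom3 : om ^ 3 <= 6 * (eps * h)).
{ assert (om <= (v + 2) * h).
  { assert (v * (eta * h) <= v * (h / 2)) by (apply Rmult_le_compat_l; lra).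
    assert (eps * h <= 1 * h) by (apply Rmult_le_compat_r; lra).
    assert (0 < v * h) by (apply Rmult_lt_0_compat; lra). lra. }
  apply Rle_trans with (((v + 2) * h) ^ 3); [apply pow_incr; lra|].
  rewrite Rpow_mult_distr, <- EV.
  assert (h * h <= r) by (rewrite <- (Rmult_1_l r); apply Rmult_le_compat; lra).
  assert (V * h ^ 3 = V * (h * h) * h) by ring.
  assert (V * (h * h) <= V * r) by (apply Rmult_le_compat_l; lra).
  assert (V * (h * h) * h <= eps * h) by (apply Rmult_le_compat_r; lra).
  assert (0 < eps * h) by (apply Rmult_lt_0_compat; lra). lra. }
assert (Hmain : (1 - eps) * (v * (eta * h) / 2 - 3 * eps * h) <= eta * lam).
{ apply Rmult_le_reg_l with h; [lra|].
  apply Rle_trans with (eta * h * sin lam).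
  2:{ replace (h * (eta * lam)) with (eta * h * lam) by ring.
      apply Rmult_le_compat_l; lra. }
  apply Rle_trans with (p * sin lam); [|apply Rmult_le_compat_r; lra].
  rewrite <- Hsine.
  apply Rle_trans with (h * (1 - eps) * sin om); [|apply Rmult_le_compat_r; lra].
  rewrite <- Rmult_assoc. apply Rmult_le_compat_l; [apply Rmult_le_pos; lra|]. lra. }
assert (Hlam : (v / 2 * eta - (3 + v / 2) * eps) * h <= eta * lam).
{ apply Rle_trans with (2 := Hmain).
  assert (0 <= eps * (eps * h)) by (repeat apply Rmult_le_pos; lra).
  assert (0 <= v * (eps * h) * (1 - eta)) by (repeat apply Rmult_le_pos; lra).
  lra. }
assert (Hgoal : eta * ((v - delta) * h) <= eta * (th (q + h) - th q)); [|now apply Rmult_le_reg_l with eta].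
apply Rle_trans with (eta * ((v / 2 - 5 * eps) * s + lam)).
2:{ apply Rmult_le_compat_l; [lra|]. unfold lam in *. lra. }
assert (G1 : eps * (16 + v) * h <= eta * delta * h) by (apply Rmult_le_compat_r; lra).
assert (G2 : eta * v * (eta * h) <= delta * (eta * h)) by (apply Rmult_le_compat_r; lra).
assert (G3 : eta * (eps * s) <= 1 * (eps * h)).
{ apply Rmult_le_compat; try lra; [apply Rmult_le_pos; lra|apply Rmult_le_compat_l; lra]. }
unfold s in *. lra.
Qed.

End RightTurning.

Lemma turning_left c A th lo hi q v delta : chord_angles c A th lo hi -> lo < q < hi ->
  0 < v -> chord_curv_near c lo hi q v -> 0 < delta ->
  exists r, 0 < r /\ forall x, x < q -> q - r < x -> lo < x ->
    (v - delta) * (q - x) <= th q - th x.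
Proof.
intros Hca Hq Hv Hc Hd.
destruct (turning_right _ _ _ _ _ (- q) v (chord_angles_mirror _ _ _ _ _ Hca) ltac:(lra) Hv
  (chord_curv_near_mirror _ _ _ _ _ Hc) delta Hd) as [r [Hr H]].
exists r. split; trivial. intros x Hx Hxr Hlo.
specialize (H (- x) ltac:(lra) ltac:(lra) ltac:(lra)). rewrite !Ropp_involutive in H. lra.
Qed.

(** * Local lower bounds on turning, infinite curvature included *)

Definition curv_ge_near (c : R -> R -> R) (lo hi q k : R) : Prop :=
  (exists v, k <= v /\ chord_curv_near c lo hi q v) \/
  forall M, exists d, 0 < d /\ forall x y, lo < x -> x <= q -> q <= y -> y < hi ->
    x < y -> y - x < d -> M < kappa0 (y - x) (c x y).

Lemma curv_ge_near_mirror c lo hi q k : curv_ge_near c lo hi q k ->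
  curv_ge_near (fun x y => c (- y) (- x)) (- hi) (- lo) (- q) k.
Proof.
intros [[v [Hv H]]|H].
- left. exists v. split; trivial. now apply chord_curv_near_mirror.
- right. intros M. destruct (H M) as [d [Hd H']]. exists d. split; trivial.
  intros x y Hx Hxq Hqy Hy Hxy Hd'. replace (y - x) with (- x - - y) by ring.
  apply H'; lra.
Qed.

(** The constant is far from sharp, which is harmless where the arc/chord curvature
    is infinite. *)
Lemma turning_ge_kappa0 l c M tau : 0 < l -> 0 < c <= l -> 0 < M -> M < kappa0 l c ->
  0 <= tau -> l * cos tau <= c -> M * l / 8 <= tau.
Proof.
intros Hl Hc HM Hk Ht Hcos.
destruct (kappa0_chord_bounds l c Hl Hc) as [Hx [_ B]].
set (x := kappa0 l c * l / 2) in *.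
assert (HP := PI_4).
assert (HMx : M * l / 2 <= x) by (unfold x; nra).
assert (HMl : 0 < M * l) by nra.
clearbody x.
assert (Hx2 : x ^ 2 <= 16).
{ replace 16 with (4 ^ 2) by ring. apply pow_incr; lra. }
assert (Hx4 : x ^ 4 <= 16 * x ^ 2).
{ replace (x ^ 4) with (x ^ 2 * x ^ 2) by ring.
  apply Rmult_le_compat_r; [apply pow2_ge_0|trivial]. }
assert (Hq := cos_ge_quadratic tau).
(* The number [30] comes from [1 / 6 - 16 / 120 = 1 / 30]. Hence [tau ^ 2 >= x ^ 2 / 15], and
   [2 * sqrt 15 < 8] yields the final constant. *)
assert (H1 : l * (1 - tau ^ 2 / 2) <= l * (1 - x ^ 2 / 30)).
{ apply Rle_trans with (l * cos tau); [apply Rmult_le_compat_l; lra|].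
  apply Rle_trans with c; trivial. apply Rle_trans with (1 := B).
  apply Rmult_le_compat_l; lra. }
apply Rmult_le_reg_l in H1; trivial.
assert (HM2 : (M * l / 2) ^ 2 <= x ^ 2) by (apply pow_incr; lra).
apply Rnot_lt_le; intros Hlt.
assert (tau ^ 2 <= (M * l / 8) ^ 2) by (apply pow_incr; lra).
assert (0 < (M * l) ^ 2) by (apply pow_lt; lra).
lra.
Qed.

Lemma local_turning c A th lo hi q k delta : chord_angles c A th lo hi ->
  (forall x y, lo < x -> x < y -> y < hi -> th y - th x <= PI / 2 ->
     (y - x) * cos (th y - th x) <= c x y) ->
  lo < q < hi -> 0 < k -> curv_ge_near c lo hi q k -> 0 < delta ->
  exists r, 0 < r /\ forall x y, lo < x -> x <= q -> q <= y -> y < hi -> y - x < r ->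
    (k - delta) * (y - x) <= th y - th x.
Proof.
intros Hca Hlow Hq Hk [[v [Hkv Hv]]|Hinf] Hdelta.
- destruct (turning_right _ _ _ _ _ q v Hca Hq ltac:(lra) Hv delta Hdelta) as [r1 [Hr1 H1]].
  destruct (turning_left _ _ _ _ _ q v delta Hca Hq ltac:(lra) Hv Hdelta) as [r2 [Hr2 H2]].
  exists (Rmin r1 r2). split; [now apply Rmin_glb_lt|].
  intros x y Hx Hxq Hqy Hy Hr.
  assert (R1 := Rmin_l r1 r2). assert (R2 := Rmin_r r1 r2).
  assert (A1 : (v - delta) * (y - q) <= th y - th q).
  { destruct Hqy as [Hqy|<-]; [apply H1; lra|lra]. }
  assert (A2 : (v - delta) * (q - x) <= th q - th x).
  { destruct Hxq as [Hxq| ->]; [apply H2; lra|lra]. }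
  apply Rle_trans with ((v - delta) * (y - x)); [|lra].
  apply Rmult_le_compat_r; lra.
(* The factor [8] cancels the loss in [turning_ge_kappa0]. The radius [1 / k] keeps [k * (y - x)]
   below [PI / 2], so a turn above [PI / 2] needs no estimate. *)
- destruct (Hinf (8 * k)) as [d [Hd H]].
  assert (HP := PI2_1).
  set (r := Rmin d (1 / k)).
  assert (Hr : 0 < r) by (apply Rmin_glb_lt; trivial; apply Rdiv_lt_0_compat; lra).
  exists r. split; trivial.
  intros x y Hx Hxq Hqy Hy Hyx.
  assert (R1 : r <= d) by apply Rmin_l.
  assert (R2 : r * k <= 1) by (apply Rle_div_mult; [lra|apply Rmin_r]).
  destruct (Req_dec x y) as [<-|Hne].
  { assert (x = q) by lra; subst. lra. }
  assert (Hxy : x < y) by lra.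
  assert (Ht := ca_tangent _ _ _ _ _ Hca x y Hx Hxy Hy).
  assert (Hkl : k * (y - x) <= 1) by nra.
  assert (k * (y - x) <= th y - th x).
  { destruct (Rle_dec (th y - th x) (PI / 2)) as [Hs|Hs]; [|lra].
    assert (E := turning_ge_kappa0 (y - x) (c x y) (8 * k) (th y - th x) ltac:(lra)
      (ca_length _ _ _ _ _ Hca x y Hx Hxy Hy) ltac:(lra) (H x y Hx Hxq Hqy Hy Hxy ltac:(lra))
      ltac:(lra) (Hlow x y Hx Hxy Hy Hs)). lra. }
  nra.
Qed.

(** * Half arcs *)

Lemma cos_sub_le x y : x <= y -> cos x - cos y <= y - x.
Proof.
intros [H| ->]; [|lra].
destruct (MVT_cor2 cos (fun t => - sin t) x y H) as [u [Hu _]].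
{ intros; apply derivable_pt_lim_cos. }
generalize (SIN_bound u). nra.
Qed.

Lemma sin_sub_le x y : x <= y -> sin x - sin y <= y - x.
Proof.
intros [H| ->]; [|lra].
destruct (MVT_cor2 sin cos x y H) as [u [Hu _]].
{ intros; apply derivable_pt_lim_sin. }
generalize (COS_bound u). nra.
Qed.

(** No derivative of [f] is available. On a short interval the mean slope of sine differs little
    from the cosine at the left end, and Cousin's lemma sums these small errors. *)
Lemma integrate_cos_bound (f : R -> R) k a s t : 0 < k -> s <= t ->
  (forall x y, s <= x -> x < y -> y <= t -> f y - f x <= cos (k * (x - a)) * (y - x)) ->
  f t - f s <= (sin (k * (t - a)) - sin (k * (s - a))) / k.
Proof.
intros Hk Hst Hf.
apply Rnot_lt_le; intros Hlt.
set (G x := f x - sin (k * (x - a)) / k).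
set (eps := (G t - G s) / (t - s + 1)).
assert (HG : 0 < G t - G s) by (unfold G; lra).
assert (He : 0 < eps) by (apply Rdiv_lt_0_compat; lra).
assert (Hee : eps * (t - s + 1) = G t - G s) by (unfold eps; field; lra).
assert (H : G t - G s <= eps * (t - s)); [|lra].
apply (interval_induction (fun x y => G y - G x <= eps * (y - x)) s t Hst).
- intros; lra.
- intros q Hq. exists (eps / k). split; [now apply Rdiv_lt_0_compat|].
  intros x y Hx Hy Hxy.
  destruct (Req_dec x y) as [<-|Hne]; [lra|].
  assert (Hxy' : x < y) by lra.
  assert (Hd : (y - x) * k <= eps) by (apply Rle_div_mult; lra).
  assert (Hkxy : k * (x - a) < k * (y - a)) by (apply Rmult_lt_compat_l; lra).
  destruct (MVT_cor2 sin cos (k * (x - a)) (k * (y - a)) Hkxy) as [u [Hu Hu2]].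
  { intros; apply derivable_pt_lim_sin. }
  assert (Hc := cos_sub_le (k * (x - a)) u ltac:(lra)).
  assert (Hfxy := Hf x y ltac:(lra) Hxy' ltac:(lra)).
  assert (Es : sin (k * (y - a)) / k - sin (k * (x - a)) / k = cos u * (y - x)).
  { transitivity ((sin (k * (y - a)) - sin (k * (x - a))) / k); [field; lra|].
    rewrite Hu. field; lra. }
  unfold G.
  assert ((cos (k * (x - a)) - cos u) * (y - x) <= eps * (y - x)); [|lra].
  apply Rmult_le_compat_r; lra.
Qed.

Lemma lt_of_sin_sub_pos x y : 0 <= x <= PI -> 0 <= y <= PI -> 0 < sin (y - x) -> x < y.
Proof.
intros Hx Hy H. apply Rnot_le_lt; intros Hle.
assert (0 <= sin (x - y)) by (apply sin_ge_0; lra).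
replace (y - x) with (- (x - y)) in H by ring. rewrite sin_neg in H. lra.
Qed.

Lemma polar_angle x y r : 0 < r -> r ^ 2 = x ^ 2 + y ^ 2 -> 0 <= y ->
  r * cos (acos (x / r)) = x /\ r * sin (acos (x / r)) = y.
Proof.
intros Hr Heq Hy.
assert (Hb : -1 <= x / r <= 1).
{ split; apply Rmult_le_reg_r with r; trivial; unfold Rdiv; rewrite Rmult_assoc, Rinv_l; nra. }
assert (Hc : r * cos (acos (x / r)) = x) by (rewrite cos_acos by trivial; field; lra).
split; trivial.
assert (Hs : 0 <= sin (acos (x / r))) by (apply sin_ge_0; apply acos_bound).
set (t := acos (x / r)) in *. clearbody t.
assert (Hsc := sin2_cos2 t). unfold Rsqr in Hsc.
assert (E : (r * sin t) ^ 2 = y ^ 2).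
{ transitivity (r ^ 2 * (sin t * sin t + cos t * cos t) - (r * cos t) ^ 2); [ring|].
  rewrite Hsc, Hc. lra. }
apply Rsqr_inj; trivial; [apply Rmult_le_pos; lra|]. now rewrite !Rsqr_pow2.
Qed.

Lemma exists_inf (S : R -> Prop) m : (exists x, S x) -> (forall x, S x -> m <= x) ->
  exists i, (forall x, S x -> i <= x) /\ (forall j, (forall x, S x -> j <= x) -> j <= i).
Proof.
intros [x0 Hx0] Hm.
destruct (completeness (fun x => S (- x))) as [u [Hu1 Hu2]].
- exists (- m). intros x Hx. specialize (Hm _ Hx). lra.
- exists (- x0). now rewrite Ropp_involutive.
- exists (- u). split.
  + intros x Hx. assert (- x <= u); [|lra]. apply Hu1. now rewrite Ropp_involutive.
  + intros j Hj. assert (u <= - j); [|lra]. apply Hu2. intros x Hx. specialize (Hj _ Hx). lra.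
Qed.

Definition chord_len (g : R -> pt) (x y : R) : R := dist2 (g x) (g y).

(** All that the comparison needs of the arclength parametrization; unlike the
    latter, it is immediately invariant under reversal of the parameter. *)
Definition chord_rate_bound (g : R -> pt) : Prop :=
  forall (f : R -> R) m x y, x <= y ->
    (forall u w, x <= u -> u < w -> w <= y -> f w - f u <= m * chord_len g u w) ->
    f y - f x <= m * (y - x).

(** For [m < 0] shortness of chords points the wrong way. Dividing by [m] instead bounds every
    polygonal length by [(f y - f x) / m], and arclength is their least upper bound. *)
Lemma arclength_chord_rate_bound g : arclength_param g -> chord_rate_bound g.
Proof.
intros Harc f m x y Hxy Hf.
destruct (Req_dec x y) as [<-|Hne]; [lra|].
destruct (Rle_dec 0 m) as [Hm|Hm].
- apply Rle_trans with (m * chord_len g x y); [apply Hf; lra|].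
  apply Rmult_le_compat_l; trivial.
  apply Rle_trans with (1 := arclength_lipschitz g Harc x y).
  rewrite Rabs_minus_sym, Rabs_right; lra.
- destruct (Harc x y Hxy) as [_ Hlub].
  assert (y - x <= (f y - f x) / m).
  { apply Hlub. intros z [p [n [[H0 [Hn Hmon]] ->]]].
    apply Rmult_le_reg_r with (- m); [lra|].
    replace ((f y - f x) / m * - m) with (- (f y - f x)) by (field; lra).
    assert (Hi : forall i, (i <= n)%nat -> x <= p i <= y /\ f (p i) - f x <= m * polysum g p i).
    { assert (Hle : forall i j, (i <= j)%nat -> (j <= n)%nat -> p i <= p j).
      { intros i j Hij. induction Hij as [|j Hij IH]; intros Hj; [lra|].
        generalize (Hmon j ltac:(lia)) (IH ltac:(lia)). lra. }
      induction i as [|i IH]; intros Hin.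
      - simpl. rewrite H0. lra.
      - destruct (IH ltac:(lia)) as [I1 I2].
        assert (Hs := Hmon i ltac:(lia)).
        assert (Hb := Hle (S i) n ltac:(lia) ltac:(lia)).
        split; [lra|]. simpl.
        destruct (Req_dec (p i) (p (S i))) as [E|E].
        + rewrite <- E. assert (dist2 (g (p i)) (g (p i)) = 0) as ->; [|lra].
          unfold dist2. rewrite !Rminus_diag.
          replace (0 ^ 2 + 0 ^ 2) with 0 by ring. apply sqrt_0.
        + assert (Hu := Hf (p i) (p (S i)) ltac:(lra) ltac:(lra) ltac:(lra)).
          unfold chord_len in Hu. rewrite dist2_sym in Hu. lra. }
    destruct (Hi n (le_n n)) as [_ Hp]. rewrite Hn in Hp. lra. }
  apply Rmult_le_compat_r with (r := - m) in H; [|lra].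
  replace ((f y - f x) / m * - m) with (- (f y - f x)) in H by (field; lra). lra.
Qed.

(** If the height dropped from [x] to [y], the heights at [a], [x], [y], [b] would force one of
    three triples to turn the wrong way. *)
Lemma convex_arc_monotone (g : R -> pt) a b :
  (forall x y z, a <= x -> x < y -> y < z -> z <= b -> 0 < orient (g x) (g y) (g z)) ->
  (forall x, a <= x <= b -> snd (g a) <= snd (g x)) ->
  (forall x, a <= x -> x < b -> snd (g x) < snd (g b)) ->
  forall x y, a <= x -> x < y -> y <= b -> snd (g x) <= snd (g y).
Proof.
intros Hor Hmin Hmax x y Hx Hxy Hy.
destruct (Req_dec y b) as [->|Hyb]; [left; apply Hmax; lra|].
destruct (Req_dec a x) as [<-|Hax]; [apply Hmin; lra|].
apply Rnot_lt_le; intros Hlt.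
assert (O1 := Hor a x y ltac:(lra) ltac:(lra) Hxy ltac:(lra)).
assert (O2 := Hor x y b ltac:(lra) ltac:(lra) ltac:(lra) ltac:(lra)).
assert (O3 := Hor a x b ltac:(lra) ltac:(lra) ltac:(lra) ltac:(lra)).
assert (M1 := Hmin y ltac:(lra)). assert (M2 := Hmax x ltac:(lra) ltac:(lra)).
unfold orient in *.
set (p1 := fst (g x) - fst (g a)). set (q1 := snd (g x) - snd (g a)).
set (p2 := fst (g y) - fst (g x)). set (q2 := snd (g x) - snd (g y)).
set (p3 := fst (g b) - fst (g y)). set (q3 := snd (g b) - snd (g y)).
assert (P1 : 0 < q2) by (unfold q2; lra). assert (P2 : q2 <= q1) by (unfold q1, q2; lra).
assert (P3 : q2 < q3) by (unfold q2, q3; lra).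
assert (C1 : 0 < - p1 * q2 - q1 * p2) by (unfold p1, q2, q1, p2; lra).
assert (C2 : 0 < p2 * q3 + q2 * p3) by (unfold p2, q3, q2, p3; lra).
assert (C3 : 0 < p1 * (q3 - q2) - q1 * (p3 + p2)) by (unfold p1, q3, q2, q1, p3, p2; lra).
clearbody p1 p2 p3 q1 q2 q3.
(* With these weights the three orientations sum to zero identically. *)
assert (0 < (- p1 * q2 - q1 * p2) * (q3 - q2)) by (apply Rmult_lt_0_compat; lra).
assert (0 < (p2 * q3 + q2 * p3) * q1) by (apply Rmult_lt_0_compat; lra).
assert (0 < (p1 * (q3 - q2) - q1 * (p3 + p2)) * q2) by (apply Rmult_lt_0_compat; lra).
lra.
Qed.

Section HalfArc.

Variables (g : R -> pt) (E : R -> Prop) (k a b : R).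
Hypothesis Hab : a < b.
Hypothesis Hk : 0 < k.
Hypothesis Hlip : forall x y, dist2 (g x) (g y) <= Rabs (x - y).
Hypothesis Hrate : chord_rate_bound g.
Hypothesis Hor :
  forall x y z, a <= x -> x < y -> y < z -> z <= b -> 0 < orient (g x) (g y) (g z).
Hypothesis Hup : forall x y, a <= x -> x < y -> y <= b -> snd (g x) <= snd (g y).
Hypothesis Hnull : null_set E.
Hypothesis Hcurv : forall q, a < q < b -> ~ E q -> curv_ge_near (chord_len g) a b q k.

(** Along the half arc the second coordinate never decreases, so [acos] determines the polar
    angle. *)
Let chord_angle x y : R := acos ((fst (g y) - fst (g x)) / chord_len g x y).

Lemma chord_len_bounds x y : a < x -> x < y -> y < b -> 0 < chord_len g x y <= y - x.
Proof.
intros Hx Hxy Hy. split.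
- apply dist2_pos. intros Exy. assert (H := Hor x y b ltac:(lra) Hxy Hy ltac:(lra)).
  unfold orient in H. rewrite Exy in H. lra.
- apply Rle_trans with (1 := Hlip x y). rewrite Rabs_minus_sym, Rabs_right; lra.
Qed.

Lemma chord_polar x y : a < x -> x < y -> y < b ->
  chord_len g x y * cos (chord_angle x y) = fst (g y) - fst (g x) /\
  chord_len g x y * sin (chord_angle x y) = snd (g y) - snd (g x).
Proof.
intros Hx Hxy Hy. apply polar_angle.
- now apply chord_len_bounds.
- unfold chord_len. rewrite dist2_sqr. ring.
- assert (H := Hup x y ltac:(lra) Hxy ltac:(lra)). lra.
Qed.

Lemma chord_angle_bounds x y : 0 <= chord_angle x y <= PI.
Proof. apply acos_bound. Qed.

(** The sine of the difference of two chord angles, times both lengths, is the orientation of the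
    triple. *)
Lemma chord_angle_mono x y z : a < x -> x < y -> y < z -> z < b ->
  chord_angle x y < chord_angle x z < chord_angle y z.
Proof.
intros Hx Hxy Hyz Hz.
assert (O := Hor x y z ltac:(lra) Hxy Hyz ltac:(lra)). unfold orient in O.
destruct (chord_polar x y Hx Hxy ltac:(lra)) as [C1 S1].
destruct (chord_polar x z Hx ltac:(lra) Hz) as [C2 S2].
destruct (chord_polar y z ltac:(lra) Hyz Hz) as [C3 S3].
assert (L1 := chord_len_bounds x y Hx Hxy ltac:(lra)).
assert (L2 := chord_len_bounds x z Hx ltac:(lra) Hz).
assert (L3 := chord_len_bounds y z ltac:(lra) Hyz Hz).
split; apply lt_of_sin_sub_pos; try apply chord_angle_bounds; rewrite sin_minus.
- apply Rmult_lt_reg_l with (chord_len g x y * chord_len g x z).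
  + apply Rmult_lt_0_compat; lra.
  + rewrite Rmult_0_r.
    replace (_ * (_ - _)) with
      ((chord_len g x y * cos (chord_angle x y)) * (chord_len g x z * sin (chord_angle x z))
       - (chord_len g x y * sin (chord_angle x y)) * (chord_len g x z * cos (chord_angle x z))) by ring.
    rewrite C1, C2, S1, S2. lra.
- apply Rmult_lt_reg_l with (chord_len g x z * chord_len g y z).
  + apply Rmult_lt_0_compat; lra.
  + rewrite Rmult_0_r.
    replace (_ * (_ - _)) with
      ((chord_len g x z * cos (chord_angle x z)) * (chord_len g y z * sin (chord_angle y z))
       - (chord_len g x z * sin (chord_angle x z)) * (chord_len g y z * cos (chord_angle y z))) by ring.
    rewrite C2, C3, S2, S3. lra.
Qed.

(** The witness [th x] is the infimum of the angles of chords starting at [x]. An angle arriving at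
    [y] is below all angles leaving [y], hence below [th y]. *)
Lemma exists_tangent_angle : exists th : R -> R,
  chord_angles (chord_len g) chord_angle th a b /\ (forall x, a < x < b -> 0 <= th x <= PI).
Proof.
assert (Hinf : forall x, exists i, a < x < b ->
  (forall y, x < y < b -> i <= chord_angle x y) /\
  (forall j, (forall y, x < y < b -> j <= chord_angle x y) -> j <= i)).
{ intros x. destruct (classic (a < x < b)) as [Hx|Hx].
  2:{ exists 0. intros; contradiction. }
  destruct (exists_inf (fun t => exists y, x < y < b /\ t = chord_angle x y) 0) as [i [I1 I2]].
  - exists (chord_angle x ((x + b) / 2)), ((x + b) / 2). split; [lra|trivial].
  - intros t [y [_ ->]]. apply chord_angle_bounds.
  - exists i. intros _. split.
    + intros y Hy. apply I1. now exists y.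
    + intros j Hj. apply I2. intros t [y [Hy ->]]. now apply Hj. }
exists (fun x => proj1_sig (constructive_indefinite_description _ (Hinf x))).
assert (Hth : forall x, a < x < b ->
  (forall y, x < y < b -> proj1_sig (constructive_indefinite_description _ (Hinf x)) <= chord_angle x y) /\
  (forall j, (forall y, x < y < b -> j <= chord_angle x y) ->
     j <= proj1_sig (constructive_indefinite_description _ (Hinf x)))).
{ intros x Hx. exact (proj2_sig (constructive_indefinite_description _ (Hinf x)) Hx). }
revert Hth.
generalize (fun x => proj1_sig (constructive_indefinite_description _ (Hinf x))).
intros th Hth. split.
- constructor.
  + apply chord_len_bounds.
  + intros x y z Hx Hxy Hyz Hz.
    destruct (chord_polar x y Hx Hxy ltac:(lra)) as [-> _].
    destruct (chord_polar x z Hx ltac:(lra) Hz) as [-> _].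
    destruct (chord_polar y z ltac:(lra) Hyz Hz) as [-> _]. ring.
  + intros x y z Hx Hxy Hyz Hz.
    destruct (chord_polar x y Hx Hxy ltac:(lra)) as [_ ->].
    destruct (chord_polar x z Hx ltac:(lra) Hz) as [_ ->].
    destruct (chord_polar y z ltac:(lra) Hyz Hz) as [_ ->]. ring.
  + intros x y z Hx Hxy Hyz Hz.
    generalize (chord_angle_mono x y z Hx Hxy Hyz Hz) (chord_angle_bounds x y)
      (chord_angle_bounds y z). lra.
  + intros x y Hx Hxy Hy. split.
    * apply Hth; lra.
    * apply Hth; [lra|]. intros z Hz.
      generalize (chord_angle_mono x y z Hx Hxy ltac:(lra) ltac:(lra)). lra.
- intros x Hx. split.
  + apply Hth; [lra|]. intros; apply chord_angle_bounds.
  + apply Rle_trans with (chord_angle x ((x + b) / 2)); [apply Hth; lra|apply chord_angle_bounds].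
Qed.

Lemma tangent_angle_growth th : chord_angles (chord_len g) chord_angle th a b ->
  forall x y, a < x -> x <= y -> y < b -> k * (y - x) <= th y - th x.
Proof.
intros Hca.
assert (Hmon : forall x y, a < x -> x <= y -> y < b -> th x <= th y).
{ intros x y Hx [Hxy| ->] Hy; [|lra].
  generalize (ca_tangent _ _ _ _ _ Hca x y Hx Hxy Hy). lra. }
assert (Hlow : forall x y, a < x -> x < y -> y < b -> th y - th x <= PI / 2 ->
  (y - x) * cos (th y - th x) <= chord_len g x y).
{ intros x y Hx Hxy Hy Hs.
  (* Minus the projection on the tangent direction at [x]: every chord in between makes an angle of
     at most [th y - th x] with it, so projection keeps at least that cosine of the length. *)
  set (f s := - (cos (th x) * fst (g s) + sin (th x) * snd (g s))).
  assert (Hf : forall u w, a < u -> u < w -> w < b ->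
    f w - f u = - (chord_len g u w * cos (chord_angle u w - th x))).
  { intros u w Hu Huw Hw. destruct (chord_polar u w Hu Huw Hw) as [C S].
    rewrite cos_minus. unfold f.
    transitivity (- (cos (th x) * (fst (g w) - fst (g u)) + sin (th x) * (snd (g w) - snd (g u)))); [ring|].
    rewrite <- C, <- S. ring. }
  assert (H : f y - f x <= - cos (th y - th x) * (y - x)).
  { apply Hrate; [lra|]. intros u w Hu Huw Hw. rewrite Hf by lra.
    assert (L := chord_len_bounds u w ltac:(lra) Huw ltac:(lra)).
    assert (T := ca_tangent _ _ _ _ _ Hca u w ltac:(lra) Huw ltac:(lra)).
    assert (T1 := Hmon x u Hx Hu ltac:(lra)). assert (T2 := Hmon w y ltac:(lra) Hw Hy).
    assert (cos (th y - th x) <= cos (chord_angle u w - th x)) by (apply cos_decr_1; lra).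
    assert (chord_len g u w * cos (th y - th x) <= chord_len g u w * cos (chord_angle u w - th x))
      by (apply Rmult_le_compat_l; lra). lra. }
  rewrite Hf in H by lra.
  assert (L := chord_len_bounds x y Hx Hxy Hy).
  assert (chord_len g x y * cos (chord_angle x y - th x) <= chord_len g x y * 1)
    by (apply Rmult_le_compat_l; [lra|apply COS_bound]). lra. }
intros x y Hx Hxy Hy.
apply le_epsilon; intros eps Heps.
set (delta := Rmin k (eps / (y - x + 1))).
assert (Hd : 0 < delta) by (apply Rmin_glb_lt; trivial; apply Rdiv_lt_0_compat; lra).
assert (Hd1 : delta <= k) by apply Rmin_l.
assert (Hd2 : delta * (y - x + 1) <= eps) by (apply Rle_div_mult; [lra|apply Rmin_r]).
assert (H : (k - delta) * (y - x) <= th y - th x); [|lra].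
apply (monotone_growth th E); trivial; try lra.
- intros u w Hu Huw Hw. apply Hmon; lra.
- intros q Hq HEq.
  destruct (local_turning _ _ _ _ _ q k delta Hca Hlow ltac:(lra) Hk
    (Hcurv q ltac:(lra) HEq) Hd) as [r [Hr H]].
  exists r. split; trivial. intros u w Hu Hw Huw. apply H; lra.
Qed.

(** Since [th] starts at least at [0], ends at most at [PI] and grows at rate [k], it dominates
    [k * (x - a)]; cosine decreases on this range, so the horizontal extent is at most the integral
    of [cos (k * (x - a))]. *)
Lemma half_arc_bound :
  k * (b - a) <= PI /\ fst (g b) - fst (g a) <= sin (k * (b - a)) / k.
Proof.
destruct exists_tangent_angle as [th [Hca Hth]].
assert (Hgrow := tangent_angle_growth th Hca).
assert (HP := PI_RGT_0).
(* [th] is controlled only inside the arc, so the growth starts at [a + s]; the shift costs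
   [k * s <= d / 2]. *)
assert (Hthk : forall x, a < x < b -> k * (x - a) <= th x).
{ intros x Hx. apply Rnot_lt_le; intros Hlt.
  set (d := k * (x - a) - th x). set (s := Rmin ((x - a) / 2) (d / (2 * k))).
  assert (Hd : 0 < d) by (unfold d; lra).
  assert (Hs : 0 < s) by (apply Rmin_glb_lt; [lra|apply Rdiv_lt_0_compat; lra]).
  assert (Hs1 : s <= (x - a) / 2) by apply Rmin_l.
  assert (Hs2 : s * (2 * k) <= d) by (apply Rle_div_mult; [lra|apply Rmin_r]).
  assert (H := Hgrow (a + s) x ltac:(lra) ltac:(lra) ltac:(lra)).
  assert (H0 := Hth (a + s) ltac:(lra)). unfold d in *. lra. }
assert (HkPI : k * (b - a) <= PI).
{ apply Rnot_lt_le; intros Hlt.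
  set (d := k * (b - a) - PI). set (s := Rmin ((b - a) / 2) (d / (2 * k))).
  assert (Hd : 0 < d) by (unfold d; lra).
  assert (Hs : 0 < s) by (apply Rmin_glb_lt; [lra|apply Rdiv_lt_0_compat; lra]).
  assert (Hs1 : s <= (b - a) / 2) by apply Rmin_l.
  assert (Hs2 : s * (2 * k) <= d) by (apply Rle_div_mult; [lra|apply Rmin_r]).
  assert (H := Hthk (b - s) ltac:(lra)).
  assert (H0 := Hth (b - s) ltac:(lra)). unfold d in *. lra. }
split; trivial.
assert (Hint : forall s t, a < s -> s <= t -> t < b ->
  fst (g t) - fst (g s) <= (sin (k * (t - a)) - sin (k * (s - a))) / k).
{ intros s t Hs Hst Ht.
  apply (integrate_cos_bound (fun x => fst (g x))); trivial.
  intros x y Hx Hxy Hy. apply (Hrate (fun x => fst (g x))); [lra|].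
  intros u w Hu Huw Hw.
  destruct (chord_polar u w ltac:(lra) Huw ltac:(lra)) as [<- _].
  assert (L := chord_len_bounds u w ltac:(lra) Huw ltac:(lra)).
  rewrite Rmult_comm. apply Rmult_le_compat_r; [lra|].
  assert (T := ca_tangent _ _ _ _ _ Hca u w ltac:(lra) Huw ltac:(lra)).
  assert (T1 := Hthk u ltac:(lra)). assert (T2 := chord_angle_bounds u w).
  assert (k * (x - a) <= k * (u - a)) by (apply Rmult_le_compat_l; lra).
  assert (0 <= k * (x - a)) by (apply Rmult_le_pos; lra).
  apply cos_decr_1; lra. }
assert (Hfst : forall x y, x <= y -> fst (g y) - fst (g x) <= y - x).
{ intros x y Hxy. apply Rnot_lt_le; intros Hlt.
  assert (H := Hlip y x). rewrite Rabs_right in H by lra.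
  assert (N : dist2 (g y) (g x) < fst (g y) - fst (g x)) by lra.
  apply dist2_near in N. destruct N as [N _]. apply Rabs_def2 in N. lra. }
apply le_epsilon; intros eps Heps.
(* Each removed end piece contributes at most [e], and so does the change in sine divided by [k]:
   three times [eps / 3]. *)
set (e := Rmin ((b - a) / 4) (eps / 3)).
assert (He : 0 < e) by (apply Rmin_glb_lt; lra).
assert (He1 : e <= (b - a) / 4) by apply Rmin_l.
assert (He2 : e <= eps / 3) by apply Rmin_r.
assert (H1 := Hint (a + e) (b - e) ltac:(lra) ltac:(lra) ltac:(lra)).
assert (H2 := Hfst a (a + e) ltac:(lra)). assert (H3 := Hfst (b - e) b ltac:(lra)).
assert (H4 : 0 <= sin (k * (a + e - a))).
{ apply sin_ge_0.
  - apply Rmult_le_pos; lra.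
  - apply Rle_trans with (2 := HkPI). apply Rmult_le_compat_l; lra. }
assert (H5 := sin_sub_le (k * (b - e - a)) (k * (b - a)) ltac:(apply Rmult_le_compat_l; lra)).
assert (H6 : (sin (k * (b - e - a)) - sin (k * (a + e - a))) / k <= (sin (k * (b - a)) + k * e) / k).
{ apply Rmult_le_compat_r; [left; now apply Rinv_0_lt_compat|]. lra. }
replace ((sin (k * (b - a)) + k * e) / k) with (sin (k * (b - a)) / k + e) in H6 by (field; lra).
lra.
Qed.

End HalfArc.

(** * Both halves of an arc *)

(** Reversal flips the orientation and the reflection restores it, so the left half, read from the
    lowest point outwards, satisfies the same hypotheses as the right half. *)
Definition mirror_curve (g : R -> pt) (s : R) : pt := (- fst (g (- s)), snd (g (- s))).

Lemma chord_len_mirror g x y : chord_len (mirror_curve g) x y = chord_len g (- y) (- x).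
Proof. unfold chord_len, mirror_curve, dist2; simpl; f_equal; ring. Qed.

Lemma orient_mirror g x y z :
  orient (mirror_curve g x) (mirror_curve g y) (mirror_curve g z) =
  orient (g (- z)) (g (- y)) (g (- x)).
Proof. unfold orient, mirror_curve; simpl; ring. Qed.

Lemma chord_rate_bound_mirror g : chord_rate_bound g -> chord_rate_bound (mirror_curve g).
Proof.
intros H f m x y Hxy Hf.
assert (B := H (fun s => - f (- s)) m (- y) (- x) ltac:(lra)).
simpl in B. rewrite !Ropp_involutive in B.
assert (- f x - - f y <= m * (- x - - y)); [|lra].
apply B. intros u w Hu Huw Hw.
assert (F := Hf (- w) (- u) ltac:(lra) ltac:(lra) ltac:(lra)).
rewrite chord_len_mirror, !Ropp_involutive in F. lra.
Qed.

Lemma null_set_opp E : null_set E -> null_set (fun x => E (- x)).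
Proof.
intros H eps Heps. destruct (H eps Heps) as [u [v [Huv [Hcov Hlen]]]].
exists (fun n => - v n), (fun n => - u n). split; [|split].
- intros n. specialize (Huv n). lra.
- intros x Hx. destruct (Hcov _ Hx) as [n Hn]. exists n. lra.
- intros N. rewrite (sum_eq _ (fun n => v n - u n)); trivial. intros; ring.
Qed.

Lemma curv_ge_near_ext c c' lo hi q k : (forall x y, c x y = c' x y) ->
  curv_ge_near c lo hi q k -> curv_ge_near c' lo hi q k.
Proof.
intros Hc [[v [Hv H]]|H].
- left. exists v. split; trivial. intros e He. destruct (H e He) as [d [Hd H']].
  exists d. split; trivial. intros. rewrite <- Hc. now apply H'.
- right. intros M. destruct (H M) as [d [Hd H']].
  exists d. split; trivial. intros. rewrite <- Hc. now apply H'.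
Qed.

Lemma curv_ge_near_sub c lo hi lo' hi' q k : lo <= lo' -> hi' <= hi ->
  curv_ge_near c lo hi q k -> curv_ge_near c lo' hi' q k.
Proof.
intros Hlo Hhi [[v [Hv H]]|H].
- left. exists v. split; trivial. intros e He. destruct (H e He) as [d [Hd H']].
  exists d. split; trivial. intros. apply H'; lra.
- right. intros M. destruct (H M) as [d [Hd H']].
  exists d. split; trivial. intros. apply H'; lra.
Qed.

(** The arc hangs below its horizontal chord and is cut at a lowest point [m]. The two halves may
    turn by different amounts; concavity of sine makes the balanced case extremal, which is the
    circular arc. *)
Lemma convex_arc_chord_bound (g : R -> pt) E k a b : a < b -> 0 < k ->
  (forall x y, dist2 (g x) (g y) <= Rabs (x - y)) -> chord_rate_bound g ->
  (forall x y z, a <= x -> x < y -> y < z -> z <= b -> 0 < orient (g x) (g y) (g z)) ->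
  null_set E -> (forall q, a < q < b -> ~ E q -> curv_ge_near (chord_len g) a b q k) ->
  snd (g a) = snd (g b) -> fst (g a) < fst (g b) ->
  k * (b - a) <= 2 * PI /\ fst (g b) - fst (g a) <= 2 / k * sin (k * (b - a) / 2).
Proof.
intros Hab Hk Hlip Hrate Hor Hnull Hcurv Hsnd Hfst.
assert (Hbelow : forall x, a < x < b -> snd (g x) < snd (g a)).
{ intros x Hx. assert (H := Hor a x b ltac:(lra) ltac:(lra) ltac:(lra) ltac:(lra)).
  unfold orient in H. rewrite <- Hsnd in H. nra. }
assert (Hcont : continuity (fun s => snd (g s))).
{ apply lipschitz_continuity with 1; [lra|]. intros x y. rewrite Rmult_1_l.
  apply Rle_trans with (2 := Hlip x y). apply Rnot_lt_le; intros H.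
  apply dist2_near in H. destruct H as [_ H]. rewrite Rabs_minus_sym in H. lra. }
destruct (continuity_ab_min (fun s => snd (g s)) a b ltac:(lra) ltac:(intros; apply Hcont))
  as [m [Hmin Hm]].
assert (Hm' : a < m < b).
{ assert (H1 := Hbelow ((a + b) / 2) ltac:(lra)).
  assert (H2 := Hmin ((a + b) / 2) ltac:(lra)).
  split; apply Rnot_le_lt; intros Hle; [assert (m = a) by lra|assert (m = b) by lra];
    subst m; simpl in *; lra. }
destruct (half_arc_bound g E k m b) as [R1 R2]; trivial; try lra.
{ intros. apply Hor; lra. }
{ apply convex_arc_monotone.
  - intros; apply Hor; lra.
  - intros; apply Hmin; lra.
  - intros; rewrite <- Hsnd; apply Hbelow; lra. }
{ intros q Hq HE. apply (curv_ge_near_sub _ a b); try lra. apply Hcurv; trivial; lra. }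
destruct (half_arc_bound (mirror_curve g) (fun x => E (- x)) k (- m) (- a)) as [L1 L2];
  trivial; try lra.
{ intros x y. change (chord_len (mirror_curve g) x y <= Rabs (x - y)).
  rewrite chord_len_mirror. apply Rle_trans with (1 := Hlip _ _). right; f_equal; ring. }
{ now apply chord_rate_bound_mirror. }
{ intros. rewrite orient_mirror. apply Hor; lra. }
{ apply convex_arc_monotone.
  - intros. rewrite orient_mirror. apply Hor; lra.
  - intros. simpl. rewrite Ropp_involutive. apply Hmin; lra.
  - intros. simpl. rewrite Ropp_involutive. apply Hbelow; lra. }
{ now apply null_set_opp. }
{ intros q Hq HE. apply (curv_ge_near_ext (fun x y => chord_len g (- y) (- x))).
  - intros; now rewrite chord_len_mirror.
  - apply (curv_ge_near_sub _ (- b) (- a)); try lra.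
    replace q with (- - q) by ring. apply curv_ge_near_mirror. apply Hcurv; trivial; lra. }
simpl in L2. rewrite !Ropp_involutive in L2.
replace (- a - - m) with (m - a) in * by ring.
split; [lra|].
set (x := k * (b - m)) in *. set (y := k * (m - a)) in *.
apply Rle_trans with (sin x / k + sin y / k); [lra|].
replace (k * (b - a) / 2) with ((x + y) / 2) by (unfold x, y; field).
assert (Hx : 0 <= x) by (unfold x; apply Rmult_le_pos; lra).
assert (Hy : 0 <= y) by (unfold y; apply Rmult_le_pos; lra).
assert (Hs : sin x + sin y = 2 * sin ((x + y) / 2) * cos ((x - y) / 2)).
{ rewrite form3. ring. }
replace (sin x / k + sin y / k) with (2 / k * (sin ((x + y) / 2) * cos ((x - y) / 2)))
  by (transitivity ((sin x + sin y) / k); [rewrite Hs|]; field; lra).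
apply Rmult_le_compat_l; [left; apply Rdiv_lt_0_compat; lra|].
assert (0 <= sin ((x + y) / 2)) by (apply sin_ge_0; lra).
generalize (COS_bound ((x - y) / 2)). nra.
Qed.

(** Orthonormal coordinates with first axis [(e1, e2)]; [o = -1] reverses the orientation. *)
Definition frame_curve (e1 e2 o : R) (g : R -> pt) (s : R) : pt :=
  (e1 * fst (g s) + e2 * snd (g s), o * (e1 * snd (g s) - e2 * fst (g s))).

Lemma chord_len_frame e1 e2 o g x y : e1 ^ 2 + e2 ^ 2 = 1 -> o ^ 2 = 1 ->
  chord_len (frame_curve e1 e2 o g) x y = chord_len g x y.
Proof.
intros He Ho. unfold chord_len, frame_curve, dist2; simpl fst; simpl snd. f_equal.
set (X := fst (g x) - fst (g y)). set (Y := snd (g x) - snd (g y)).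
transitivity ((e1 * X + e2 * Y) ^ 2 + o ^ 2 * (e1 * Y - e2 * X) ^ 2); [unfold X, Y; ring|].
rewrite Ho. transitivity ((e1 ^ 2 + e2 ^ 2) * (X ^ 2 + Y ^ 2)); [ring|]. rewrite He; ring.
Qed.

Lemma orient_frame e1 e2 o g x y z : e1 ^ 2 + e2 ^ 2 = 1 ->
  orient (frame_curve e1 e2 o g x) (frame_curve e1 e2 o g y) (frame_curve e1 e2 o g z) =
  o * orient (g x) (g y) (g z).
Proof.
intros He. transitivity (o * (e1 ^ 2 + e2 ^ 2) * orient (g x) (g y) (g z)).
- unfold orient, frame_curve; simpl; ring.
- rewrite He; ring.
Qed.

Lemma arc_chord_curv_ge_near g L kappa a b q : b - a < L ->
  arc_chord_curv_ge g L (g q) kappa -> curv_ge_near (chord_len g) a b q kappa.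
Proof.
intros HL [[v [Hlim Hv]]|Hinf].
- left. exists v. split; trivial. intros e He. destruct (Hlim e He) as [d [Hd H]].
  exists d. split; trivial. intros x y Hx Hxq Hqy Hy Hxy Hd'.
  apply H; try lra. exists q. split; [lra|trivial].
- right. intros M. destruct (Hinf M) as [d [Hd H]].
  exists d. split; trivial. intros x y Hx Hxq Hqy Hy Hxy Hd'.
  apply H; try lra. exists q. split; [lra|trivial].
Qed.

Theorem theorem2p9 (g : R -> pt) (L kappa : R) :
  closed_convex_curve g L ->
  0 < kappa ->
  null_set (fun s => ~ arc_chord_curv_ge g L (g s) kappa) ->
  forall a b, a < b -> b - a < L -> kappa <= kappa0_arc g a b.
Proof.
intros Hg Hk Hnull a b Hab HbL.
assert (Hne := fun s t u => orient_neq_0 g L kappa s t u Hg Hk Hnull).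
assert (Hinj := closed_curve_injective_mod g L Hg).
destruct Hg as [HL [Harc _]].
assert (Hlip := arclength_lipschitz g Harc).
set (c := dist2 (g a) (g b)).
assert (Hc : 0 < c) by (apply dist2_pos, Hinj; lra).
assert (Hcl : c <= b - a).
{ apply Rle_trans with (1 := Hlip a b). rewrite Rabs_minus_sym, Rabs_right; lra. }
set (e1 := (fst (g b) - fst (g a)) / c). set (e2 := (snd (g b) - snd (g a)) / c).
assert (He1 : e1 * c = fst (g b) - fst (g a)) by (unfold e1; field; lra).
assert (He2 : e2 * c = snd (g b) - snd (g a)) by (unfold e2; field; lra).
assert (He : e1 ^ 2 + e2 ^ 2 = 1).
{ apply Rmult_eq_reg_r with (c ^ 2); [|nra].
  transitivity ((e1 * c) ^ 2 + (e2 * c) ^ 2); [ring|].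
  rewrite He1, He2. unfold c. rewrite dist2_sqr. ring. }
(* The curve may run clockwise; [o] records the sign, and the frame then makes every triple
   positive. *)
assert (Ho : exists o, o ^ 2 = 1 /\
  forall s t u, s < t -> t < u -> u < s + L -> 0 < o * orient (g s) (g t) (g u)).
{ destruct (orient_constant_sign g L Hlip Hne) as [H|H]; [exists 1|exists (-1)];
    (split; [ring|]); intros s t u Hst Htu HuL; specialize (H s t u Hst Htu HuL); lra. }
destruct Ho as [o [Ho2 Ho]].
set (h := frame_curve e1 e2 o g).
assert (Hch : forall x y, chord_len h x y = chord_len g x y)
  by (intros; now apply chord_len_frame).
assert (Hfst : fst (h b) - fst (h a) = c).
{ unfold h; simpl.
  transitivity (e1 * (e1 * c) + e2 * (e2 * c)); [rewrite He1, He2; ring|].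
  transitivity ((e1 ^ 2 + e2 ^ 2) * c); [ring|]. rewrite He; ring. }
destruct (convex_arc_chord_bound h (fun s => ~ arc_chord_curv_ge g L (g s) kappa) kappa a b)
  as [B1 B2]; trivial.
- intros x y. change (chord_len h x y <= Rabs (x - y)). rewrite Hch. apply Hlip.
- intros f m x y Hxy Hf. apply (arclength_chord_rate_bound g Harc); trivial.
  intros. rewrite <- Hch. now apply Hf.
(* As [b - a < L], every increasing triple in [[a, b]] fits in one period. *)
- intros x y z Hx Hxy Hyz Hz. unfold h. rewrite orient_frame by trivial. apply Ho; lra.
- intros q Hq HE. apply NNPP in HE. apply (curv_ge_near_ext (chord_len g)); auto.
  now apply arc_chord_curv_ge_near with L.
- apply Rminus_diag_uniq. unfold h; simpl.
  transitivity (o * (e2 * (fst (g b) - fst (g a)) - e1 * (snd (g b) - snd (g a)))); [ring|].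
  rewrite <- He1, <- He2. ring.
- lra.
- unfold kappa0_arc. fold c. apply kappa0_ge; lra.
Qed.
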